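(* Let $\rho$ be an $n$-qubit density operator, $O$ a Hermitian observable, and consider the parametrized circuit $$U(\vec\theta)=\prod_{l=1}^M V_l e^{-i\theta_{\mathcal S(l)}H_l}=V_1e^{-i\theta_{\mathcal S(1)}H_1}\cdots V_Me^{-i\theta_{\mathcal S(M)}H_M},$$ with fixed unitaries $V_l$, Hermitian generators $H_l$, independent parameters $\vec\theta=(\theta_1,\dots,\theta_m)\in\mathbb{R}^m$ ($m\le M$) and a surjective map $\mathcal S:\{1,\dots,M\}\to\{1,\dots,m\}$ assigning to each generator its parameter (so parameters may be shared arbitrarily). Let $\mathcal{L}(\vec\theta)=\operatorname{Tr}[U(\vec\theta)\rho U^\dagger(\vec\theta)O]$. Fix $\vec\phi\in\mathbb{R}^m$ and any $p\in\{1,\dots,m\}$. Define $c_p(\vec\phi)=\big|\frac{\partial^2\mathcal{L}}{\partial\theta_p^2}(\vec\phi)\big|$ and, for each $q$, $\omega^{(\max)}_q=\sum_{l\in\mathcal S^{-1}(q)}\big(\lambda_{\max}(H_l)-\lambda_{\min}(H_l)\big)$. Let $$r_{\mathrm{patch}}^2:=\frac{9c_p(\vec\phi)^2}{8\Big(16c_p(\vec\phi)\|O\|_\infty(\omega^{(\max)}_p)^2\sum_{q\ne p}(\omega^{(\max)}_q)^2+32\|O\|_\infty^2(\omega^{(\max)}_p)^6\Big)}.$$ Then for every $r>0$ with $r^2\le r_{\mathrm{patch}}^2$, $$\operatorname{Var}_{\vec\theta\sim\mathcal{U}(\vec\phi,r)}[\mathcal{L}(\vec\theta)]\ge\frac{r^4}{45}\left(\Big(c_p(\vec\phi)-\tfrac83\|O\|_\infty(\omega^{(\max)}_p)^2\Big(\sum_{q\ne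 p}(\omega^{(\max)}_q)^2\Big)r^2\Big)^2-\tfrac{32}{3}\|O\|_\infty^2(\omega^{(\max)}_p)^6r^2\right),$$ and $$\operatorname{Var}_{\vec\theta\sim\mathcal{U}(\vec\phi,r_{\mathrm{patch}})}[\mathcal{L}(\vec\theta)]\ge\frac{1}{72}c_p(\vec\phi)^2r_{\mathrm{patch}}^4.$$ Finally, for a family of such instances indexed by $n$ with $\|O\|_\infty,\|H_k\|_\infty\in\mathcal{O}(\mathrm{poly}(n))$ and $c_p(\vec\phi)\in\Omega(1/\mathrm{poly}(n))$, choosing $r\in\Theta\big(1/(\mathrm{poly}(n)\sqrt m)\big)$ gives $\operatorname{Var}_{\vec\theta\sim\mathcal{U}(\vec\phi,r)}[\mathcal{L}(\vec\theta)]\in\Omega\big(1/(\mathrm{poly}(n)m^2)\big)$.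
   Context: $\|\cdot\|_\infty$ is the operator norm; $\lambda_{\max},\lambda_{\min}$ are the largest and smallest eigenvalues. $\mathcal S^{-1}(q)$ is the set of generator indices $l$ with $\mathcal S(l)=q$. For $\vec\phi\in\mathbb{R}^m$, $r>0$, $\mathcal{U}(\vec\phi,r)$ is the uniform distribution over $\{\vec\theta:\theta_i\in[\phi_i-r,\phi_i+r]\ \forall i\}$.
   Formalization: In the final asymptotic claim it is additionally assumed that the number of generators sharing each parameter, |S^{-1}(q)|, is O(poly(n)); without it the claim fails, e.g. m=1, M=2^n, V_l=I, H_l=Z/2, O=4^{-n}X, where L=4^{-n}cos(2^n θ). *)

(* Defs.v *)
From HB Require Import structures.
From mathcomp Require Import all_boot all_order all_algebra.
From mathcomp Require Import complex.
From mathcomp Require Import all_classical all_reals all_analysis.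

Set Implicit Arguments.
Unset Strict Implicit.
Unset Printing Implicit Defensive.

Import Order.TTheory GRing.Theory Num.Theory.
Import numFieldNormedType.Exports.
Local Open Scope ring_scope.
Local Open Scope classical_set_scope.

Section QuantumDefs.
Variable R : realType.
Local Notation C := (R[i]).

Definition adjmx {k l : nat} (A : 'M[C]_(k, l)) : 'M[C]_(l, k) :=
  (map_mx (@conjc R) A)^T.

Definition hermitian_mx {k : nat} (A : 'M[C]_k) : Prop := adjmx A = A.

Definition unitary_mx {k : nat} (A : 'M[C]_k) : Prop := A *m adjmx A = 1%:M.

Definition density_op {k : nat} (rho : 'M[C]_k) : Prop :=
  [/\ hermitian_mx rho,
      (forall v : 'cV[C]_k, 0 <= complex.Re ((adjmx v *m rho *m v) 0 0)) &
      \tr rho = 1].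

Definition sqmod (z : C) : R := complex.Re z ^+ 2 + complex.Im z ^+ 2.
Definition vnorm {k : nat} (v : 'cV[C]_k) : R :=
  Num.sqrt (\sum_(i < k) sqmod (v i 0)).

Definition opnorm {k : nat} (A : 'M[C]_k) : R :=
  sup [set vnorm (A *m v) | v in [set v : 'cV[C]_k | vnorm v = 1]].

(* largest / smallest eigenvalue of a Hermitian matrix (eigenvalues are real) *)
Definition lmax {k : nat} (H : 'M[C]_k) : R :=
  sup [set a : R | eigenvalue H (a%:C)%C].
Definition lmin {k : nat} (H : 'M[C]_k) : R :=
  inf [set a : R | eigenvalue H (a%:C)%C].

Definition mxpow {k : nat} (A : 'M[C]_k) (j : nat) : 'M[C]_k :=
  iter j (mulmx A) 1%:M.
Definition expm_partial {k : nat} (A : 'M[C]_k) (N : nat) : 'M[C]_k :=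
  \sum_(j < N) ((j`!%:R)^-1 *: mxpow A j).
Definition seqlim (u : R^nat) : R := limn u.
Definition expm {k : nat} (A : 'M[C]_k) : 'M[C]_k :=
  \matrix_(i, j) ((seqlim (fun N => complex.Re (expm_partial A N i j)))
                  +i* (seqlim (fun N => complex.Im (expm_partial A N i j))))%C.

Definition evol {k : nat} (t : R) (H : 'M[C]_k) : 'M[C]_k :=
  expm ((- (t *i))%C *: H).

Definition circuit {k m M : nat} (S : 'I_M -> 'I_m) (V H : 'I_M -> 'M[C]_k)
  (theta : 'I_m -> R) : 'M[C]_k :=
  foldr (fun l acc => V l *m evol (theta (S l)) (H l) *m acc) 1%:M (enum 'I_M).

(* L(theta) = Tr[U rho U^dagger O] (real since rho, O Hermitian) *)
Definition loss {k m M : nat} (S : 'I_M -> 'I_m) (V H : 'I_M -> 'M[C]_k)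
  (rho O : 'M[C]_k) (theta : 'I_m -> R) : R :=
  let U := circuit S V H theta in complex.Re (\tr (U *m rho *m adjmx U *m O)).

Definition upd {m : nat} (theta : 'I_m -> R) (p : 'I_m) (t : R) : 'I_m -> R :=
  fun q => if q == p then t else theta q.

Definition cp {m : nat} (L : ('I_m -> R) -> R) (phi : 'I_m -> R) (p : 'I_m) : R :=
  `| derive1n 2 (fun t => L (upd phi p t)) (phi p) |.

Definition omega_max {k m M : nat} (S : 'I_M -> 'I_m) (H : 'I_M -> 'M[C]_k)
  (q : 'I_m) : R :=
  \sum_(l < M | S l == q) (lmax (H l) - lmin (H l)).

(* Expectation w.r.t. the uniform distribution U(phi, r) on the box
   prod_i [phi_i - r, phi_i + r], written as the iterated integral of the
   normalised 1-d Lebesgue integrals over the coordinates in s. *)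
Fixpoint box_iter {m : nat} (phi : 'I_m -> R) (r : R) (s : seq 'I_m)
  (f : ('I_m -> R) -> R) (theta : 'I_m -> R) : R :=
  match s with
  | [::] => f theta
  | i :: s' => (2 * r)^-1 *
      Rintegral (@lebesgue_measure R) `[phi i - r, phi i + r]
        (fun t => box_iter phi r s' f (upd theta i t))
  end.

Definition unif_mean {m : nat} (phi : 'I_m -> R) (r : R)
  (f : ('I_m -> R) -> R) : R := box_iter phi r (enum 'I_m) f phi.

Definition unif_var {m : nat} (phi : 'I_m -> R) (r : R)
  (f : ('I_m -> R) -> R) : R :=
  unif_mean phi r (fun theta => (f theta - unif_mean phi r f) ^+ 2).

End QuantumDefs.

Unset Implicit Arguments.
Record pqc_instance (R : realType) (n : nat) := PQC {
  pq_m : nat;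
  pq_M : nat;
  pq_S : 'I_pq_M -> 'I_pq_m;
  pq_V : 'I_pq_M -> 'M[R[i]]_(2 ^ n);
  pq_H : 'I_pq_M -> 'M[R[i]]_(2 ^ n);
  pq_rho : 'M[R[i]]_(2 ^ n);
  pq_O : 'M[R[i]]_(2 ^ n);
  pq_surj : forall q, exists l, pq_S l = q;
  pq_unitary : forall l, unitary_mx (pq_V l);
  pq_hermH : forall l, hermitian_mx (pq_H l);
  pq_density : density_op pq_rho;
  pq_hermO : hermitian_mx pq_O }.
Arguments pq_m {R n}. Arguments pq_M {R n}. Arguments pq_S {R n}.
Arguments pq_V {R n}. Arguments pq_H {R n}. Arguments pq_rho {R n}.
Arguments pq_O {R n}.
Set Implicit Arguments.

Definition pq_loss {R : realType} {n : nat} (I : pqc_instance R n) :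
  ('I_(pq_m I) -> R) -> R :=
  loss (pq_S I) (pq_V I) (pq_H I) (pq_rho I) (pq_O I).
Arguments pq_loss {R n} I _.

(* Main.v *)
Require Import Defs.
From HB Require Import structures.
From mathcomp Require Import all_boot all_order all_algebra.
From mathcomp Require Import complex spectral.
From mathcomp Require Import all_classical all_reals all_analysis.
From mathcomp Require Import ring lra.

(** Test the loss against [h = (theta_p - phi_p)^2 - r^2 / 3], a centred function
of the single coordinate [p] with second moment [4 r^4 / 45]: by Cauchy-Schwarz
the variance is at least [45 / (4 r^4)] times [E[L h]^2].  A fourth order Taylor
expansion in [theta_p] gives [E[L h] = (2 r^4 / 45) E[d_p^2 L (theta_p = phi_p)]]
up to [|d_p^4 L| r^6 / 180], and averaging a coordinate [q <> p] moves
[d_p^2 L] by at most [|d_q^2 d_p^2 L| r^2 / 6], because the first order term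
averages to zero.

All the derivatives are controlled in the Heisenberg picture: differentiating
[e^{itH} X e^{-itH}] inserts the commutator [i [H, X]], where [H] may be replaced
by [H] minus the midpoint of its spectrum, of norm [(lmax H - lmin H) / 2].  Each
derivative in [theta_q] thus costs a factor [omega_q], and [|Tr (rho X)| <= |X|].
These bounds are sharper than the constants of the theorem, so that the passage
from [(c - a - b)^2] to the difference [(c - a)^2 - b'] is absorbed by
[c <= |O| omega_p^2]. *)

Set Implicit Arguments.
Unset Strict Implicit.
Unset Printing Implicit Defensive.

Import Order.TTheory GRing.Theory Num.Theory.
Import numFieldNormedType.Exports.
Local Open Scope ring_scope.
Local Open Scope classical_set_scope.

(** * Taylor bounds *)

Section Taylor.
Variable R : realType.
Implicit Types (f df g : R -> R) (a x r M : R).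

(** The mean over the box is an iterated one-dimensional integral, so linearity and monotonicity
    have to be justified at every level of the iteration. The class [box_lipschitz], stable under
    sums, products and partial averaging, supplies integrability at each level, and no interchange
    of integrals is needed. The prefactor [r^4 / 45] of the theorem is [1 / E[h^2]], that is
    [45 / (4 r^4)], times the square of [E[h^2] / 2], that is [2 r^4 / 45], the weight of the second
    derivative in [E[L h]]. The fourth order remainder enters the bound as an error [K w^4 r^2 / 8]
    next to [c], whereas the theorem subtracts a multiple of [K^2 w^6 r^2] outside the square.
    Expanding the square produces the product of that error with [c], and [c <= K w^2] turns this
    product into the required form. When the error is too large for the square to be expanded, the
    claimed lower bound is not positive, and nonnegativity of the variance suffices. *)

Lemma scale_mul (u v : R) : u *: v = u * v.
Proof. by []. Qed.

Lemma is_derive_continuous f df : (forall x, is_derive x 1 f (df x)) ->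
  continuous f.
Proof.
move=> fE x; apply/differentiable_continuous/derivable1_diffP.
by have [] := fE x.
Qed.

Lemma mvt_line f df : (forall x, is_derive x 1 f (df x)) ->
  forall a b, a <= b -> exists2 c, a <= c <= b & f b - f a = df c * (b - a).
Proof.
move=> fE a b ab.
have cf : {within `[a, b], continuous f}.
  exact/continuous_subspaceT/is_derive_continuous.
have [c] := MVT_segment ab (fun x _ => fE x) cf.
by rewrite in_itv /= => cab ->; exists c.
Qed.

Lemma bounded_derive_lip f df M : (forall x, is_derive x 1 f (df x)) ->
  (forall x, `|df x| <= M) -> forall s t, `|f s - f t| <= M * `|s - t|.
Proof.
move=> fE dfM s t; wlog ts : s t / t <= s.
  by move=> H; have [/H//|/ltW/H] := leP t s; rewrite distrC [`|s - _|]distrC.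
have [c _ ->] := mvt_line fE ts.
by rewrite normrM ler_wpM2r.
Qed.

(** The majorant minus [f] vanishes at [a] and has a nonnegative derivative to the right of [a], so
    the mean value theorem makes it nonnegative there. *)
Lemma taylor_step_right f df a M n : (forall x, is_derive x 1 f (df x)) ->
  f a = 0 -> (forall x, a <= x -> df x <= M * (x - a) ^+ n / n`!%:R) ->
  forall x, a <= x -> f x <= M * (x - a) ^+ n.+1 / n.+1`!%:R.
Proof.
move=> fE fa dfM x ax.
pose g y := M * (y - a) ^+ n.+1 / n.+1`!%:R - f y.
pose dg y := M * (y - a) ^+ n / n`!%:R - df y.
have gE (y : R) : is_derive y 1 g (dg y).
  rewrite /g.
  have h : is_derive y 1 (fun y : R => M * (y - a) ^+ n.+1 / n.+1`!%:R)
           (M * (y - a) ^+ n / n`!%:R).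
    have -> : (fun y : R => M * (y - a) ^+ n.+1 / n.+1`!%:R) =
       ((M / n.+1`!%:R) \*: ((id - cst a) ^+ n.+1 : R -> R)).
      by apply/funext => z /=; rewrite mulrAC /GRing.scale /= fctE.
    apply: is_derive_eq; rewrite /= /GRing.scale /= subr0 mulr1 fctE.
    rewrite factS natrM invfM.
    have : n.+1%:R != 0 :> R by rewrite pnatr_eq0.
    have : n`!%:R != 0 :> R by rewrite pnatr_eq0 -lt0n fact_gt0.
    by move=> ? ?; field; apply/andP.
  exact: (@is_deriveB _ _ _ _ _ _ _ _ _ h (fE y)).
have [c /andP[ac _]] := mvt_line gE ax.
rewrite {2}/g subrr expr0n /= mulr0 mul0r fa !subr0 => gx.
by rewrite -subr_ge0 -/(g x) gx mulr_ge0 ?subr_ge0// dfM.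
Qed.

Lemma is_derive_reflect f df a : (forall x, is_derive x 1 f (df x)) ->
  forall x, is_derive x 1 (fun y => f (a - y)) (- df (a - x)).
Proof.
move=> fE x.
have h : is_derive x 1 (fun y : R => a - y) (-1).
  by rewrite -[-1]sub0r; exact: (@is_deriveB _ _ _ (cst a) id).
by have := @is_derive1_comp _ f (fun y => a - y) x _ _ (fE _) h; rewrite mulrN1.
Qed.

(** Integrates a remainder estimate once, gaining one order. The half-line left of [a] is carried to
    the right one by the reflection [x |-> 2a - x]. *)
Lemma taylor_step f df a M n : (forall x, is_derive x 1 f (df x)) ->
  f a = 0 -> (forall x, `|df x| <= M * `|x - a| ^+ n / n`!%:R) ->
  forall x, `|f x| <= M * `|x - a| ^+ n.+1 / n.+1`!%:R.
Proof.
move=> fE fa dfM.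
have right (g dg : R -> R) : (forall x, is_derive x 1 g (dg x)) -> g a = 0 ->
    (forall x, `|dg x| <= M * `|x - a| ^+ n / n`!%:R) ->
    forall x, a <= x -> `|g x| <= M * `|x - a| ^+ n.+1 / n.+1`!%:R.
  move=> gE ga dgM x ax; have xa : `|x - a| = x - a by rewrite ger0_norm ?subr_ge0.
  have gM y : a <= y -> `|dg y| <= M * (y - a) ^+ n / n`!%:R.
    by move=> ay; rewrite -[in leRHS](ger0_norm (_ : 0 <= y - a)) ?subr_ge0.
  rewrite xa ler_norml lerNl; apply/andP; split.
    apply: (@taylor_step_right (- g) (fun x => - dg x)) => //.
    by rewrite fctE ga oppr0.
    by move=> y ay; rewrite (le_trans (ler_norm _)) ?normrN ?gM.
  apply: (@taylor_step_right g dg) => //.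
  by move=> y ay; rewrite (le_trans (ler_norm _)) ?gM.
move=> x; have [ax|xa] := leP a x; first exact: right ax.
have xE : x = (a + a) - (a + a - x) by ring.
rewrite {1}xE.
have -> : `|x - a| = `|(a + a - x) - a| by rewrite distrC; congr `| _ |; ring.
apply: (right (fun y => f (a + a - y)) (fun y => - df (a + a - y))).
- exact: is_derive_reflect.
- by rewrite addrK.
- move=> y; rewrite normrN (le_trans (dfM _))//.
  suff -> : `|y - a| = `|a + a - y - a| by [].
  by rewrite distrC; congr `| _ |; ring.
- by lra.
Qed.

Lemma taylor2 g g1 g2 a M :
  (forall x, is_derive x 1 g (g1 x)) -> (forall x, is_derive x 1 g1 (g2 x)) ->
  (forall x, `|g2 x| <= M) ->
  forall x, `|g x - (g a + g1 a * (x - a))| <= M * `|x - a| ^+ 2 / 2.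
Proof.
move=> gE g1E g2M.
have H1 := @taylor_step (fun x => g1 x - g1 a) g2 a M 0.
have H2 := @taylor_step (fun x => g x - (g a + g1 a * (x - a)))
  (fun x => g1 x - g1 a) a M 1.
apply: H2 => [x||].
- have -> : (fun x => g x - (g a + g1 a * (x - a))) =
    g - (cst (g a) + g1 a \*: (id - cst a : R -> R)).
    by apply/funext => y.
  by apply: is_derive_eq; rewrite /GRing.scale /=; ring.
- by rewrite subrr mulr0 addr0 subrr.
- apply: H1 => [x||x].
  + by apply: is_derive_eq (subr0 _).
  + by rewrite subrr.
  + by rewrite expr0 divr1 mulr1.
Qed.

(** Each Taylor remainder is the derivative of the next one, so two uses of [taylor_step] lift the
    second order estimate for [g2] to [g]. *)
Lemma taylor4 g g1 g2 g3 g4 a M :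
  (forall x, is_derive x 1 g (g1 x)) -> (forall x, is_derive x 1 g1 (g2 x)) ->
  (forall x, is_derive x 1 g2 (g3 x)) -> (forall x, is_derive x 1 g3 (g4 x)) ->
  (forall x, `|g4 x| <= M) ->
  forall x, `|g x - (g a + g1 a * (x - a) + g2 a * ((x - a) ^+ 2 / 2)
                     + g3 a * ((x - a) ^+ 3 / 6))| <= M * `|x - a| ^+ 4 / 24.
Proof.
move=> gE g1E g2E g3E g4M.
pose T1 x := g1 x - (g1 a + g2 a * (x - a) + g3 a * ((x - a) ^+ 2 / 2)).
have T2 := taylor2 a g2E g3E g4M.
have H3 := @taylor_step T1 (fun x => g2 x - (g2 a + g3 a * (x - a))) a M 2.
apply: (@taylor_step _ T1 a M 3) => [x||].
- have -> : (fun x => g x - (g a + g1 a * (x - a) + g2 a * ((x - a) ^+ 2 / 2)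
                     + g3 a * ((x - a) ^+ 3 / 6))) =
    g - (cst (g a) + g1 a \*: (id - cst a : R -> R) +
     (g2 a / 2) \*: ((id - cst a) ^+ 2 : R -> R) +
     (g3 a / 6) \*: ((id - cst a) ^+ 3 : R -> R)).
    by apply/funext => y; rewrite !fctE /= ?scale_mul; field.
  by apply: is_derive_eq; rewrite /T1 !fctE /= ?scale_mul; field.
- by rewrite subrr !expr0n /= !mul0r !mulr0 !addr0 subrr.
- apply: H3 => [x||//].
  + have -> : T1 = g1 - (cst (g1 a) + g2 a \*: (id - cst a : R -> R) +
     (g3 a / 2) \*: ((id - cst a) ^+ 2 : R -> R)).
      by apply/funext => y; rewrite /T1 !fctE /= ?scale_mul; field.
    by apply: is_derive_eq; rewrite !fctE /= ?scale_mul; field.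
  + by rewrite /T1 subrr !expr0n /= !mul0r !mulr0 !addr0 subrr.
Qed.

End Taylor.

(** * Averages over an interval and over a box *)

Section Average.
Variable R : realType.
Local Notation mu := (@lebesgue_measure R).
Implicit Types (a r t : R) (g h : R -> R).

Definition avg a r g : R :=
  (2 * r)^-1 * Rintegral mu `[a - r, a + r] g.

Definition integrable_near a r g := mu.-integrable `[a - r, a + r] (EFin \o g).

Lemma itv_dist a r t : `[a - r, a + r]%classic t <-> `|t - a| <= r.
Proof. by rewrite /= in_itv /= ler_distl. Qed.

Lemma continuous_integrable_near a r g :
  {within `[a - r, a + r], continuous g} -> integrable_near a r g.
Proof. by apply: continuous_compact_integrable; exact: segment_compact. Qed.

(** The Lipschitz condition is asked only inside the interval, because functions on the box are
    controlled only there. *)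
Lemma lipschitz_integrable_near a r g B :
  (forall s t, `|s - a| <= r -> `|t - a| <= r -> `|g s - g t| <= B * `|s - t|) ->
  integrable_near a r g.
Proof.
move=> gB; apply: continuous_integrable_near.
apply/subspace_continuousP => x /itv_dist xar.
apply/cvgrPdist_le => e e0; rewrite near_withinE.
have B0 : 0 < `|B| + 1 by rewrite ltr_wpDl.
have d0 : 0 < e / (`|B| + 1) by rewrite divr_gt0.
apply: filterS (nbhsx_ballx x _ d0) => t; rewrite /ball /= => xt /itv_dist tar.
rewrite (le_trans (gB _ _ xar tar))//.
apply: (@le_trans _ _ ((`|B| + 1) * `|x - t|)).
  by rewrite ler_wpM2r// (le_trans (ler_norm _))// lerDl.
by rewrite mulrC -ler_pdivlMr// ltW.
Qed.

Lemma eq_avg a r g h : (forall t, `|t - a| <= r -> g t = h t) ->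
  avg a r g = avg a r h.
Proof.
move=> gh; rewrite /avg; congr (_ * _); apply: eq_Rintegral => t.
by rewrite inE => /itv_dist /gh.
Qed.

Lemma avgD a r g h : integrable_near a r g -> integrable_near a r h ->
  avg a r (fun t => g t + h t) = avg a r g + avg a r h.
Proof. by move=> ig ih; rewrite /avg RintegralD// mulrDr. Qed.

Lemma avgZ a r c g : integrable_near a r g ->
  avg a r (fun t => c * g t) = c * avg a r g.
Proof. by move=> ig; rewrite /avg RintegralZl// mulrCA. Qed.

Lemma le_avg a r g h : 0 <= r -> integrable_near a r g -> integrable_near a r h ->
  (forall t, `|t - a| <= r -> g t <= h t) -> avg a r g <= avg a r h.
Proof.
move=> r0 ig ih gh; rewrite /avg ler_wpM2l ?invr_ge0 ?mulr_ge0//.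
by apply: le_Rintegral => // t /itv_dist /gh.
Qed.

Lemma avg_ge0 a r g : 0 <= r -> (forall t, `|t - a| <= r -> 0 <= g t) ->
  0 <= avg a r g.
Proof.
move=> r0 g0; rewrite mulr_ge0 ?invr_ge0 ?mulr_ge0//.
by apply: Rintegral_ge0 => t /itv_dist /g0.
Qed.

Lemma avg_cst a r c : 0 < r -> avg a r (fun=> c) = c.
Proof.
move=> r0; rewrite /avg Rintegral_cst//= lebesgue_measure_itv/=.
rewrite lte_fin ifT; last by lra.
by rewrite /= (_ : a + r - (a - r) = 2 * r); [field; lra | ring].
Qed.

Lemma integrable_near_cst a r c : integrable_near a r (fun=> c).
Proof.
by apply: (@lipschitz_integrable_near _ _ _ 0) => s t _ _; rewrite subrr normr0 mul0r.
Qed.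

Lemma dist_avg_le a r g h B : 0 < r ->
  integrable_near a r g -> integrable_near a r h ->
  (forall t, `|t - a| <= r -> `|g t - h t| <= B) -> `|avg a r g - avg a r h| <= B.
Proof.
move=> r0 ig ih ghB.
have ic := integrable_near_cst a r B.
have sum k : integrable_near a r k -> integrable_near a r (fun t => k t + B).
  move=> ik; apply: eq_integrable (integrableD _ ik ic) => //.
have le k l : integrable_near a r k -> integrable_near a r l ->
    (forall t, `|t - a| <= r -> k t <= l t + B) -> avg a r k <= avg a r l + B.
  move=> ik il kl; rewrite -[X in _ + X](avg_cst a _ r0) -avgD//.
  by apply: le_avg => //; [exact: ltW | exact: sum].
rewrite ler_norml lerBlDr -(lerD2r (avg a r h)) subrK addrC lerBlDr.
rewrite [B + _]addrC !le// => t /ghB; rewrite ler_norml; lra.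
Qed.

Lemma continuous_shift_exp a n : continuous (fun t : R => (t - a) ^+ n).
Proof.
move=> t; apply: (@continuous_comp _ _ _ (fun x => x - a) (fun x => x ^+ n)).
  by apply: cvgB => //; exact: cvg_cst.
exact: exprn_continuous.
Qed.

Lemma integrable_near_exp a r n : integrable_near a r (fun t => (t - a) ^+ n).
Proof.
exact/continuous_integrable_near/continuous_subspaceT/continuous_shift_exp.
Qed.

Lemma avg_exp a r n : 0 < r ->
  avg a r (fun t => (t - a) ^+ n) = (~~ odd n)%:R * r ^+ n / n.+1%:R.
Proof.
move=> r0; have ar : a - r < a + r by lra.
pose F := (n.+1%:R^-1 \*: ((id - cst a) ^+ n.+1 : R -> R)).
have FE (x : R) : is_derive x 1 F ((x - a) ^+ n).
  apply: is_derive_eq; rewrite /= !scale_mul subr0 mulr1 fctE.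
  by rewrite mulrA mulVf ?mul1r ?pnatr_eq0.
have cF : continuous F := is_derive_continuous FE.
have := @continuous_FTC2 R _ F _ _ ar
  (continuous_subspaceT (@continuous_shift_exp a n)).
rewrite /avg /Rintegral => ->; last 2 first.
- split; first by move=> x _; have [] := FE x.
  + exact/cvg_at_right_filter/cF.
  + exact/cvg_at_left_filter/cF.
- by move=> x _; rewrite derive1E; have [_ ->] := FE x.
rewrite /F /= !scale_mul !fctE.
have -> : a + r - a = r by ring.
have -> : a - r - a = - r by ring.
rewrite -mulrBr exprNn -signr_odd /=.
have n0 : n.+1%:R != 0 :> R by rewrite pnatr_eq0.
rewrite exprS; move: n.+1%:R n0 => k k0.
by case: (odd n); rewrite /= ?expr0 ?expr1; field; rewrite k0 lt0r_neq0.
Qed.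

End Average.

(** * Changing one coordinate of the parameter vector *)

Section Update.
Variables (R : realType) (m : nat).
Implicit Types (theta : 'I_m -> R) (p q : 'I_m) (s t : R).

Lemma upd_same theta p t : upd theta p t p = t.
Proof. by rewrite /upd eqxx. Qed.

Lemma upd_other theta p q t : q != p -> upd theta p t q = theta q.
Proof. by rewrite /upd => /negbTE ->. Qed.

Lemma upd_upd theta p s t : upd (upd theta p s) p t = upd theta p t.
Proof. by apply/funext => q; rewrite /upd; case: eqP. Qed.

Lemma upd_self theta p : upd theta p (theta p) = theta.
Proof. by apply/funext => q; rewrite /upd; case: eqP => [->|]. Qed.

Lemma updC theta p q s t : q != p ->
  upd (upd theta p s) q t = upd (upd theta q t) p s.
Proof.
move=> qp; apply/funext => i; rewrite /upd; case: (eqVneq i q) => [->|//].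
by rewrite (negbTE qp).
Qed.

End Update.

(** * Iterated averages of functions that are Lipschitz in each coordinate *)

Section Box.
Variables (R : realType) (m : nat) (phi : 'I_m -> R) (r : R).
Hypothesis r0 : 0 < r.
Implicit Types (theta : 'I_m -> R) (p q : 'I_m) (s t : R)
  (f g : ('I_m -> R) -> R) (sq : seq 'I_m).

Definition in_box theta := forall i, `|theta i - phi i| <= r.

Lemma in_box_center : in_box phi.
Proof. by move=> i; rewrite subrr normr0 ltW. Qed.

Lemma in_box_upd theta p t : in_box theta -> `|t - phi p| <= r ->
  in_box (upd theta p t).
Proof. by move=> bth tp i; rewrite /upd; case: eqP => [->|]. Qed.

(** The sup bound accompanies the Lipschitz bound because products need both; a single constant
    serves for the two. *)
Definition box_lipschitz f := exists2 B,
  forall theta, in_box theta -> `|f theta| <= B &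
  forall theta q s t, in_box theta -> `|s - phi q| <= r -> `|t - phi q| <= r ->
    `|f (upd theta q s) - f (upd theta q t)| <= B * `|s - t|.

Lemma box_lipschitz_cst c : box_lipschitz (fun=> c).
Proof.
by exists `|c| => // *; rewrite subrr normr0 mulr_ge0.
Qed.

Lemma box_lipschitz_coord p : box_lipschitz (fun theta => theta p - phi p).
Proof.
exists (r + 1) => [theta /(_ p) tp|theta q s t _ _ _].
  by rewrite (le_trans tp)// lerDl.
have -> : upd theta q s p - phi p - (upd theta q t p - phi p) =
  upd theta q s p - upd theta q t p by ring.
rewrite /upd; case: eqP => _; first by rewrite ler_peMl// lerDr ltW.
by rewrite subrr normr0 mulr_ge0// addr_ge0// ltW.
Qed.

Lemma box_lipschitzD f g : box_lipschitz f -> box_lipschitz g ->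
  box_lipschitz (fun theta => f theta + g theta).
Proof.
move=> [B fB fL] [B' gB gL]; exists (B + B') => [theta bth|theta q s t bth sq tq].
  by rewrite (le_trans (ler_normD _ _))// lerD ?fB ?gB.
rewrite opprD addrACA (le_trans (ler_normD _ _))// mulrDl.
by rewrite lerD ?fL ?gL.
Qed.

Lemma box_lipschitzM f g : box_lipschitz f -> box_lipschitz g ->
  box_lipschitz (fun theta => f theta * g theta).
Proof.
move=> [B fB fL] [B' gB gL].
have B0 : 0 <= B := le_trans (normr_ge0 _) (fB _ in_box_center).
have B'0 : 0 <= B' := le_trans (normr_ge0 _) (gB _ in_box_center).
exists (B * B' + B * B') => [theta bth|theta q s t bth sq tq].
  rewrite normrM (le_trans (ler_pM _ _ (fB _ bth) (gB _ bth)))//.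
  by rewrite lerDl mulr_ge0.
have -> : f (upd theta q s) * g (upd theta q s) - f (upd theta q t) * g (upd theta q t)
  = f (upd theta q s) * (g (upd theta q s) - g (upd theta q t)) +
    (f (upd theta q s) - f (upd theta q t)) * g (upd theta q t) by ring.
rewrite (le_trans (ler_normD _ _))// !normrM [leRHS]mulrDl lerD//.
  by rewrite -mulrA ler_pM// ?gL// fB//; exact: in_box_upd.
by rewrite mulrAC ler_pM// ?fL// gB//; exact: in_box_upd.
Qed.

Lemma box_lipschitzX f n : box_lipschitz f ->
  box_lipschitz (fun theta => f theta ^+ n).
Proof.
move=> fL; elim: n => [|n IH].
  by under eq_fun do rewrite expr0; exact: box_lipschitz_cst.
by under eq_fun do rewrite exprS; exact: box_lipschitzM.
Qed.

Lemma box_lipschitz_freeze f p : box_lipschitz f ->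
  box_lipschitz (fun theta => f (upd theta p (phi p))).
Proof.
move=> [B fB fL].
have B0 : 0 <= B := le_trans (normr_ge0 _) (fB _ in_box_center).
have pr : `|phi p - phi p| <= r by rewrite subrr normr0 ltW.
exists B => [theta bth|theta q s t bth sq tq]; first exact/fB/in_box_upd.
have [->|pq] := eqVneq q p; first by rewrite !upd_upd subrr normr0 mulr_ge0.
have qp : p != q by rewrite eq_sym.
by rewrite !(updC _ _ _ qp) fL//; exact: in_box_upd.
Qed.

Lemma box_lipschitz_integrable f theta p : box_lipschitz f -> in_box theta ->
  integrable_near (phi p) r (fun t => f (upd theta p t)).
Proof.
move=> [B _ fL] bth; apply: (@lipschitz_integrable_near _ _ _ _ B) => s t.
exact: fL.
Qed.

Lemma box_iter_cons p sq f theta : box_iter phi r (p :: sq) f theta =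
  avg (phi p) r (fun t => box_iter phi r sq f (upd theta p t)).
Proof. by []. Qed.

(** Averaging does not increase the constant, so every inner average is again integrable in the next
    variable. *)
Lemma box_lipschitz_iter sq f : box_lipschitz f ->
  box_lipschitz (box_iter phi r sq f).
Proof.
move=> fL; elim: sq => [//|p sq IH].
have [B gB gL] := IH.
have B0 : 0 <= B := le_trans (normr_ge0 _) (gB _ in_box_center).
exists B => [theta bth|theta q s t bth sqr tqr]; rewrite !box_iter_cons.
  rewrite -[avg _ _ _]subr0 -[X in _ - X](avg_cst (phi p) _ r0).
  apply: dist_avg_le => //; first exact: box_lipschitz_integrable.
    exact: integrable_near_cst.
  by move=> t tp; rewrite subr0; exact/gB/in_box_upd.
have [->|pq] := eqVneq q p.
  under eq_avg do rewrite upd_upd.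
  under [X in _ - X]eq_avg do rewrite upd_upd.
  by rewrite subrr normr0 mulr_ge0.
have qp : p != q by rewrite eq_sym.
apply: dist_avg_le => //.
- by apply: box_lipschitz_integrable => //; exact: in_box_upd.
- by apply: box_lipschitz_integrable => //; exact: in_box_upd.
- by move=> u up; rewrite !(updC _ _ _ qp) gL//; exact: in_box_upd.
Qed.

Lemma box_iterD sq f g theta : box_lipschitz f -> box_lipschitz g ->
  in_box theta -> box_iter phi r sq (fun x => f x + g x) theta =
  box_iter phi r sq f theta + box_iter phi r sq g theta.
Proof.
move=> fL gL; elim: sq theta => [//|p sq IH] theta bth.
rewrite !box_iter_cons -avgD; try by apply: box_lipschitz_integrable => //;
  exact: box_lipschitz_iter.
by apply: eq_avg => t tp; rewrite IH//; exact: in_box_upd.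
Qed.

Lemma box_iterZ sq c f theta : box_lipschitz f ->
  in_box theta -> box_iter phi r sq (fun x => c * f x) theta =
  c * box_iter phi r sq f theta.
Proof.
move=> fL; elim: sq theta => [//|p sq IH] theta bth.
rewrite !box_iter_cons -avgZ; last by apply: box_lipschitz_integrable => //;
  exact: box_lipschitz_iter.
by apply: eq_avg => t tp; rewrite IH//; exact: in_box_upd.
Qed.

Lemma box_iter_cst sq c theta : box_iter phi r sq (fun=> c) theta = c.
Proof.
by elim: sq theta => [//|p sq IH] theta; rewrite box_iter_cons
  -[RHS](avg_cst (phi p) _ r0); apply: eq_avg => t _; exact: IH.
Qed.

Lemma le_box_iter sq f g theta : box_lipschitz f -> box_lipschitz g ->
  (forall x, in_box x -> f x <= g x) -> in_box theta ->
  box_iter phi r sq f theta <= box_iter phi r sq g theta.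
Proof.
move=> fL gL fg; elim: sq theta => [|p sq IH] theta bth; first exact: fg.
rewrite !box_iter_cons le_avg ?ltW//; try by apply: box_lipschitz_integrable => //;
  exact: box_lipschitz_iter.
by move=> t tp; apply: IH; exact: in_box_upd.
Qed.

Lemma norm_box_iter_le sq f g theta : box_lipschitz f -> box_lipschitz g ->
  (forall x, in_box x -> `|f x| <= g x) -> in_box theta ->
  `|box_iter phi r sq f theta| <= box_iter phi r sq g theta.
Proof.
move=> fL gL fg bth; rewrite ler_norml lerNl; apply/andP; split.
  rewrite -mulN1r -box_iterZ//; apply: le_box_iter => //.
    by apply: box_lipschitzM => //; exact: box_lipschitz_cst.
  by move=> x /fg; rewrite mulN1r ler_norml lerNl => /andP[].
by apply: le_box_iter => // x /fg; rewrite ler_norml => /andP[].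
Qed.

Lemma box_iter_indep sq f p theta t : (forall x s, f (upd x p s) = f x) ->
  box_iter phi r sq f (upd theta p t) = box_iter phi r sq f theta.
Proof.
move=> fp; elim: sq theta => [//|q sq IH] theta; rewrite !box_iter_cons.
apply: eq_avg => s _; have [->|pq] := eqVneq q p; first by rewrite upd_upd.
by rewrite updC// IH.
Qed.

Lemma box_iter_pull sq f p (u : R -> R) theta : p \notin sq ->
  box_lipschitz f -> in_box theta ->
  box_iter phi r sq (fun x => f x * u (x p)) theta =
  box_iter phi r sq f theta * u (theta p).
Proof.
move=> + fL; elim: sq theta => [//|q sq IH] theta.
rewrite inE negb_or => /andP[pq psq] bth; rewrite !box_iter_cons mulrC -avgZ.
  by apply: eq_avg => s sq'; rewrite IH ?upd_other// 1?mulrC//; exact: in_box_upd.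
by apply: box_lipschitz_integrable => //; exact: box_lipschitz_iter.
Qed.

(** Levels before [p] let the constant [avg (phi p) r u] pass through. At level [p], the inner
    levels treat [u] as a constant and leave a function of [f] that no longer depends on the
    averaged variable. *)
Lemma box_iter_sep sq f p (u : R -> R) theta : uniq sq -> p \in sq ->
  box_lipschitz f -> (forall x s, f (upd x p s) = f x) ->
  integrable_near (phi p) r u -> in_box theta ->
  box_iter phi r sq (fun x => f x * u (x p)) theta =
  box_iter phi r sq f theta * avg (phi p) r u.
Proof.
move=> + + fL fp iu; elim: sq theta => [//|q sq IH] theta.
rewrite cons_uniq inE !box_iter_cons => /andP[qsq usq]. have [pq _ bth|pq /= psq bth] := eqVneq p q; last first.
  rewrite mulrC -avgZ.
    by apply: eq_avg => s sq'; rewrite IH// 1?mulrC//; exact: in_box_upd.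
  by apply: box_lipschitz_integrable => //; exact: box_lipschitz_iter.
rewrite -pq in qsq *; have indep t : box_iter phi r sq f (upd theta p t) = box_iter phi r sq f theta.
  exact: box_iter_indep.
transitivity (box_iter phi r sq f theta * avg (phi p) r u).
  rewrite -avgZ//; apply: eq_avg => t tp.
  rewrite box_iter_pull ?indep ?upd_same//; exact: in_box_upd.
congr (_ * _); rewrite -[LHS](avg_cst (phi p) _ r0).
by apply: eq_avg => t _; rewrite indep.
Qed.

End Box.

(** * Functions with controlled partial derivatives *)

Section AverageTaylor.
Variable R : realType.
Implicit Types (a r x M : R) (g : R -> R).

(** Degree five is what a cubic Taylor polynomial times the quadratic test function requires.
    Shorter polynomials are given by [nth 0], whose default supplies the zero coefficients. *)
Lemma avg_quintic a r (c : nat -> R) : 0 < r ->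
  avg a r (fun t => \sum_(i < 6) c i * (t - a) ^+ i) =
  c 0%N + c 2%N * r ^+ 2 / 3 + c 4%N * r ^+ 4 / 5 /\
  integrable_near a r (fun t => \sum_(i < 6) c i * (t - a) ^+ i).
Proof.
move=> r0.
have ie i : integrable_near a r (fun t => c i * (t - a) ^+ i).
  apply/continuous_integrable_near/continuous_subspaceT => t.
  by apply: cvgMr; exact: continuous_shift_exp.
have H n : avg a r (fun t => \sum_(i < n) c i * (t - a) ^+ i) =
    \sum_(i < n) c i * ((~~ odd i)%:R * r ^+ i / i.+1%:R) /\
    integrable_near a r (fun t => \sum_(i < n) c i * (t - a) ^+ i).
  elim: n => [|n [IH1 IH2]].
    rewrite big_ord0; under eq_fun do rewrite big_ord0.
    by split; [exact: avg_cst | exact: integrable_near_cst].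
  under eq_fun do rewrite big_ord_recr /=.
  split; last by apply: eq_integrable (integrableD _ IH2 (ie n)).
  by rewrite big_ord_recr /= avgD// IH1 avgZ ?avg_exp//; exact: integrable_near_exp.
split; last exact: (H 6%N).2.
by rewrite (H 6%N).1 !big_ord_recr big_ord0 /= /bump /=; field.
Qed.

Lemma dist_avg_center a r g g1 g2 M : 0 < r ->
  (forall x, is_derive x 1 g (g1 x)) -> (forall x, is_derive x 1 g1 (g2 x)) ->
  (forall x, `|g2 x| <= M) -> `|avg a r g - g a| <= M * r ^+ 2 / 6.
Proof.
move=> r0 gE g1E g2M; have T := taylor2 a gE g1E g2M.
have ig : integrable_near a r g.
  exact/continuous_integrable_near/continuous_subspaceT/is_derive_continuous.
(* The Taylor estimate traps [g] between two parabolas, [s = 1] above and [s = -1] below. The linear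
   term averages to zero and the second moment [r^2 / 3] turns [M / 2] into [M r^2 / 6]. *)
pose c (s : R) := nth 0 [:: g a; g1 a; s * (M / 2)].
have cE s t : \sum_(i < 6) c s i * (t - a) ^+ i =
    g a + g1 a * (t - a) + s * (M / 2 * (t - a) ^+ 2).
  by rewrite !big_ord_recr big_ord0 /= /bump /= /c /=; ring.
have av s : avg a r (fun t => g a + g1 a * (t - a) + s * (M / 2 * (t - a) ^+ 2)) =
   g a + s * (M * r ^+ 2 / 6) /\
   integrable_near a r (fun t => g a + g1 a * (t - a) + s * (M / 2 * (t - a) ^+ 2)).
  have [] := avg_quintic a (c s) r0.
  by under eq_fun do rewrite cE; move=> -> ?; split => //; rewrite /c /=; field.
have norm2 t : `|t - a| ^+ 2 = (t - a) ^+ 2 by rewrite real_normK ?num_real.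
have [a1 i1] := av 1; have [a2 i2] := av (-1).
rewrite ler_distl; apply/andP; split.
  have : avg a r (fun t => g a + g1 a * (t - a) + -1 * (M / 2 * (t - a) ^+ 2)) <=
      avg a r g.
    apply: le_avg => //; first exact: ltW.
    by move=> t _; have := T t; rewrite norm2 ler_norml; lra.
  by rewrite a2; lra.
have : avg a r g <=
    avg a r (fun t => g a + g1 a * (t - a) + 1 * (M / 2 * (t - a) ^+ 2)).
  apply: le_avg => //; first exact: ltW.
  by move=> t _; have := T t; rewrite norm2 ler_norml; lra.
by rewrite a1; lra.
Qed.

End AverageTaylor.

Section ControlledDerivatives.
Variables (R : realType) (m : nat).
Implicit Types (theta : 'I_m -> R) (p q : 'I_m) (f g : ('I_m -> R) -> R).

Definition partial_at p f g := forall theta,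
  is_derive (theta p) 1 (fun t => f (upd theta p t)) (g theta).

Lemma partial_line p f g : partial_at p f g ->
  forall theta (x : R), is_derive x 1 (fun t => f (upd theta p t)) (g (upd theta p x)).
Proof.
move=> fg theta x; have := fg (upd theta p x); rewrite upd_same.
by under eq_fun do rewrite upd_upd.
Qed.

(** [w q] is the price of one derivative in coordinate [q]. Derivatives are chosen one after the
    other, in any order, so symmetry of mixed partials never has to be proved. *)
Fixpoint deriv_bounded (w : 'I_m -> R) (n : nat) (B : R) f : Prop :=
  (forall theta, `|f theta| <= B) /\
  if n is n'.+1 then
    forall q, exists2 g, partial_at q f g & deriv_bounded w n' (w q * B) g
  else True.

Variables (w : 'I_m -> R) (phi : 'I_m -> R) (r : R).
Hypothesis r0 : 0 < r.

Lemma deriv_bounded_norm n B f : deriv_bounded w n B f ->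
  forall theta, `|f theta| <= B.
Proof. by case: n => [|n] []. Qed.

Lemma deriv_bounded_partial n B f q : deriv_bounded w n.+1 B f ->
  exists2 g, partial_at q f g & deriv_bounded w n (w q * B) g.
Proof. by move=> [_ /(_ q)]. Qed.

Lemma deriv_bounded_lipschitz n B f : deriv_bounded w n.+1 B f ->
  box_lipschitz phi r f.
Proof.
move=> [fB fD]; have B0 : 0 <= B := le_trans (normr_ge0 _) (fB phi).
(* One Lipschitz constant must serve all coordinates, so their bounds are summed. *)
pose W := \sum_q `|w q * B|.
have W0 : 0 <= W by apply: sumr_ge0.
exists (B + W) => [theta _|theta q s t _ _ _].
  by rewrite (le_trans (fB _))// lerDl.
have [g fg /deriv_bounded_norm gB] := fD q.
rewrite (le_trans (bounded_derive_lip (partial_line fg theta)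
  (fun x => gB (upd theta q x)) s t))// ler_wpM2r//.
rewrite (le_trans (ler_norm _))// (le_trans (_ : _ <= W)) ?lerDr//.
by rewrite /W (bigD1 q)//= lerDl sumr_ge0.
Qed.

Definition recenter (sq : seq 'I_m) theta : 'I_m -> R :=
  fun i => if i \in sq then phi i else theta i.

(** Coordinates are recentred one at a time: the inner averages are replaced by values at the
    recentred point, uniformly in the outer variable, and the remaining average falls to
    [dist_avg_center]. The errors add up. *)
Lemma dist_box_iter_center (M : 'I_m -> R) sq f theta : uniq sq ->
  box_lipschitz phi r f ->
  (forall q, q \in sq -> exists g h,
    [/\ partial_at q f g, partial_at q g h & forall x, `|h x| <= M q]) ->
  in_box phi r theta ->
  `|box_iter phi r sq f theta - f (recenter sq theta)|
    <= (\sum_(q <- sq) M q) * r ^+ 2 / 6.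
Proof.
move=> + fL; elim: sq theta => [|p sq IH] theta.
  by move=> _ _ _; rewrite /= subrr normr0 big_nil !mul0r.
rewrite cons_uniq box_iter_cons big_cons => /andP[psq usq] fM bth.
have recE t : recenter sq (upd theta p t) = upd (recenter sq theta) p t.
  apply/funext => i; rewrite /recenter /upd; case: (eqVneq i p) => [->|//].
  by rewrite (negbTE psq).
have -> : recenter (p :: sq) theta = upd (recenter sq theta) p (phi p).
  by apply/funext => i; rewrite /recenter /upd inE; case: eqP => [->|].
have brec : in_box phi r (recenter sq theta).
  by move=> i; rewrite /recenter; case: ifP => // _; rewrite subrr normr0 ltW.
have [g [h [fg gh hM]]] := fM p (mem_head _ _).
have C := dist_avg_center (phi p) r0 (partial_line fg (recenter sq theta))
  (partial_line gh (recenter sq theta)) (fun x => hM _).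
rewrite [M p + _]addrC !mulrDl.
set A := avg _ _ _ in C; set A' := avg _ _ _; rewrite -(subrK A A') -addrA.
rewrite (le_trans (ler_normD _ _))// lerD//.
apply: dist_avg_le => //.
- by apply: box_lipschitz_integrable => //; exact: box_lipschitz_iter.
- exact: box_lipschitz_integrable.
- move=> t tp; rewrite -recE; apply: IH => //.
    by move=> q qsq; apply: fM; rewrite inE qsq orbT.
  exact: in_box_upd.
Qed.

End ControlledDerivatives.

(** * Lower bound on the variance by covariance with a quadratic *)

Section VarianceBound.
Variables (R : realType) (m : nat) (w phi : 'I_m -> R) (r : R) (p : 'I_m).
Hypothesis r0 : 0 < r.
Implicit Types (f g : ('I_m -> R) -> R).
Local Notation E := (unif_mean phi r).
Local Notation X := (fun theta : 'I_m -> R => theta p - phi p).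

Lemma unif_meanD f g : box_lipschitz phi r f -> box_lipschitz phi r g ->
  E (fun x => f x + g x) = E f + E g.
Proof. by move=> fL gL; apply: box_iterD => //; exact: in_box_center. Qed.

Lemma unif_meanZ c f : box_lipschitz phi r f -> E (fun x => c * f x) = c * E f.
Proof. by move=> fL; apply: box_iterZ => //; exact: in_box_center. Qed.

Lemma le_unif_mean f g : box_lipschitz phi r f -> box_lipschitz phi r g ->
  (forall x, in_box phi r x -> f x <= g x) -> E f <= E g.
Proof. by move=> fL gL fg; apply: le_box_iter => //; exact: in_box_center. Qed.

Lemma norm_unif_mean_le f g : box_lipschitz phi r f -> box_lipschitz phi r g ->
  (forall x, in_box phi r x -> `|f x| <= g x) -> `|E f| <= E g.
Proof. by move=> fL gL fg; apply: norm_box_iter_le => //; exact: in_box_center. Qed.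

Lemma box_lipschitz_quintic (c : nat -> R) :
  box_lipschitz phi r (fun theta => \sum_(i < 6) c i * X theta ^+ i).
Proof.
elim: 6%N => [|n IH].
  by under eq_fun do rewrite big_ord0; exact: box_lipschitz_cst.
under eq_fun do rewrite big_ord_recr /=.
exact: (box_lipschitzD IH (box_lipschitzM r0 (box_lipschitz_cst _ _ (c n))
  (box_lipschitzX r0 n (box_lipschitz_coord phi r0 p)))).
Qed.

Lemma unif_mean_quintic f (c : nat -> R) : box_lipschitz phi r f ->
  (forall x s, f (upd x p s) = f x) ->
  E (fun theta => f theta * \sum_(i < 6) c i * X theta ^+ i) =
  E f * (c 0%N + c 2%N * r ^+ 2 / 3 + c 4%N * r ^+ 4 / 5).
Proof.
move=> fL fp; have [<- iq] := avg_quintic (phi p) c r0.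
apply: (@box_iter_sep _ _ _ _ r0 _ _ _ (fun t => \sum_(i < 6) c i * (t - phi p) ^+ i))
  => //.
- exact: enum_uniq.
- exact: mem_enum.
- exact: in_box_center.
Qed.

Lemma unif_mean_poly (c : nat -> R) :
  E (fun theta => \sum_(i < 6) c i * X theta ^+ i) =
  c 0%N + c 2%N * r ^+ 2 / 3 + c 4%N * r ^+ 4 / 5.
Proof.
have := @unif_mean_quintic (fun=> 1) c (box_lipschitz_cst _ _ _) (fun _ _ => erefl).
rewrite {2}/unif_mean box_iter_cst// mul1r => <-.
by congr (E _); apply/funext => x; rewrite mul1r.
Qed.

(** A multiple of the second Legendre polynomial rescaled to the interval: orthogonal to constants
    and, by parity, to odd powers. *)
Let h (theta : 'I_m -> R) := X theta ^+ 2 - r ^+ 2 / 3.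

Let hE theta : h theta =
  \sum_(i < 6) nth 0 [:: - (r ^+ 2 / 3); 0; 1] i * X theta ^+ i.
Proof. by rewrite !big_ord_recr big_ord0 /= /bump /= /h; ring. Qed.

Let hL : box_lipschitz phi r h.
Proof. by rewrite (funext hE); exact: box_lipschitz_quintic. Qed.

Let Eh : E h = 0.
Proof. by rewrite (funext hE) unif_mean_poly /=; field. Qed.

Let Ehh : E (fun x => h x ^+ 2) = 4 / 45 * r ^+ 4.
Proof.
have -> : (fun x => h x ^+ 2) = (fun x => \sum_(i < 6)
    nth 0 [:: r ^+ 4 / 9; 0; - (2 / 3 * r ^+ 2); 0; 1] i * X x ^+ i).
  apply/funext => x.
  by rewrite !big_ord_recr big_ord0 /= /bump /= /h; field.
by rewrite unif_mean_poly /=; field.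
Qed.

(** Cauchy-Schwarz in pointwise form: [(f - mu - l h)^2 >= 0] is averaged with [l] the least squares
    coefficient [E[f h] / E[h^2]], so only linearity and monotonicity of the mean are used. *)
Lemma unif_var_ge_cov f : box_lipschitz phi r f ->
  45 / (4 * r ^+ 4) * E (fun x => f x * h x) ^+ 2 <= unif_var phi r f.
Proof.
move=> fL; set c := E (fun x => f x * h x); set mu := E f.
have fhL : box_lipschitz phi r (fun x => f x * h x) by exact: box_lipschitzM.
have hhL : box_lipschitz phi r (fun x => h x ^+ 2) by exact: box_lipschitzX.
pose l := 45 / (4 * r ^+ 4) * c.
have Z k g : box_lipschitz phi r g -> box_lipschitz phi r (fun x => k * g x).
  by move=> gL; apply: box_lipschitzM => //; exact: box_lipschitz_cst.
have -> : 45 / (4 * r ^+ 4) * c ^+ 2 =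
  E (fun x => 2 * l * (f x * h x) + (- (2 * l * mu) * h x + - l ^+ 2 * h x ^+ 2)).
  rewrite unif_meanD//; [|exact: Z|apply: box_lipschitzD; exact: Z].
  rewrite unif_meanD; [|exact: Z|exact: Z].
  rewrite !unif_meanZ// Eh Ehh -/c /l.
  by field; rewrite lt0r_neq0.
apply: le_unif_mean.
- by apply: box_lipschitzD; [exact: Z|apply: box_lipschitzD; exact: Z].
- by apply: box_lipschitzX => //; apply: box_lipschitzD => //; exact: box_lipschitz_cst.
- move=> x _; rewrite -subr_ge0.
  have -> : (f x - E f) ^+ 2 - (2 * l * (f x * h x) +
    (- (2 * l * mu) * h x + - l ^+ 2 * h x ^+ 2)) = (f x - mu - l * h x) ^+ 2.
    by rewrite -/mu; ring.
  exact: sqr_ge0.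
Qed.

Lemma cp_partial f f1 f2 : partial_at p f f1 -> partial_at p f1 f2 ->
  cp f phi p = `|f2 phi|.
Proof.
move=> ff1 f1f2; rewrite /cp /derive1n /=.
have -> : (fun t : R => f (upd phi p t))^`() = fun t => f1 (upd phi p t).
  apply/funext => t; rewrite derive1E.
  by have [_ ->] := partial_line ff1 phi t.
by rewrite derive1E; have [_ ->] := f1f2 phi.
Qed.

Lemma cov_quadratic_ge f K : (forall q, 0 <= w q) -> deriv_bounded w 4 K f ->
  2 / 45 * r ^+ 4 * (cp f phi p
     - K * w p ^+ 2 * (\sum_(q < m | q != p) w q ^+ 2) * r ^+ 2 / 6
     - K * w p ^+ 4 * r ^+ 2 / 8)
  <= `|E (fun x => f x * h x)|.
Proof.
move=> w0 fD.
have K0 : 0 <= K := le_trans (normr_ge0 _) (deriv_bounded_norm fD phi).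
have [f1 p1 D1] := deriv_bounded_partial p fD.
have [f2 p2 D2] := deriv_bounded_partial p D1.
have [f3 p3 D3] := deriv_bounded_partial p D2.
have [f4 p4 /deriv_bounded_norm M4] := deriv_bounded_partial p D3.
rewrite (cp_partial p1 p2).
have L0 := deriv_bounded_lipschitz phi r fD.
have L1 := deriv_bounded_lipschitz phi r D1.
have L2 := deriv_bounded_lipschitz phi r D2.
have L3 := deriv_bounded_lipschitz phi r D3.
(* Freezing coordinate [p] makes the Taylor coefficients independent of it, so that
   [unif_mean_quintic] can factor them out. *)
pose fz g := fun theta => g (upd theta p (phi p)).
have fzL g : box_lipschitz phi r g -> box_lipschitz phi r (fz g).
  exact: box_lipschitz_freeze.
have fzp g x s : fz g (upd x p s) = fz g x by rewrite /fz upd_upd.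
(* With [y = x p - phi p], the lists [q0] to [q3] hold the coefficients of [h], [y h], [y^2 h / 2]
   and [y^3 h / 6]. *)
pose q0 := nth 0 [:: - (r ^+ 2 / 3); 0; 1].
pose q1 := nth 0 [:: 0; - (r ^+ 2 / 3); 0; 1].
pose q2 := nth 0 [:: 0; 0; - (r ^+ 2 / 6); 0; 1 / 2].
pose q3 := nth 0 [:: 0; 0; 0; - (r ^+ 2 / 18); 0; 1 / 6].
pose P (c : nat -> R) x := \sum_(i < 6) c i * X x ^+ i.
have PL c : box_lipschitz phi r (P c) by exact: box_lipschitz_quintic.
have tL g c : box_lipschitz phi r g -> box_lipschitz phi r (fun x => fz g x * P c x).
  by move=> gL; apply: box_lipschitzM => //; exact: fzL.
pose T x := fz f x * P q0 x + (fz f1 x * P q1 x +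
  (fz f2 x * P q2 x + fz f3 x * P q3 x)).
have t0 := tL _ q0 L0; have t1 := tL _ q1 L1.
have t2 := tL _ q2 L2; have t3 := tL _ q3 L3.
have t23 := box_lipschitzD t2 t3; have t13 := box_lipschitzD t1 t23.
have TL : box_lipschitz phi r T := box_lipschitzD t0 t13.
(* [q0] has mean zero and [q1], [q3] are odd; [q2] contributes [(1/5 - 1/9) / 2 = 2/45]. *)
have ET : E T = 2 / 45 * r ^+ 4 * E (fz f2).
  rewrite (unif_meanD t0 t13) (unif_meanD t1 t23) (unif_meanD t2 t3).
  rewrite (unif_mean_quintic q0 (fzL _ L0) (fzp f)).
  rewrite (unif_mean_quintic q1 (fzL _ L1) (fzp f1)).
  rewrite (unif_mean_quintic q2 (fzL _ L2) (fzp f2)).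
  rewrite (unif_mean_quintic q3 (fzL _ L3) (fzp f3)).
  by rewrite /q0 /q1 /q2 /q3 /=; field.
pose rho x := f x * h x + -1 * T x.
have rhoL : box_lipschitz phi r rho.
  apply: box_lipschitzD; first exact: box_lipschitzM.
  by apply: box_lipschitzM => //; exact: box_lipschitz_cst.
have Efh : E (fun x => f x * h x) = 2 / 45 * r ^+ 4 * E (fz f2) + E rho.
  rewrite unif_meanD//; first last.
  - by apply: box_lipschitzM => //; exact: box_lipschitz_cst.
  - exact: box_lipschitzM.
  by rewrite unif_meanZ// ET; ring.
have Erho : `|E rho| <= K * w p ^+ 4 * r ^+ 6 / 180.
  (* The remainder [K w^4 y^4 / 24] times [|h| <= 2 r^2 / 3] gives [1/36]; the fourth moment
     [r^4 / 5] then gives [1/180]. *)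
  pose q4 := nth 0 [:: 0; 0; 0; 0; K * w p ^+ 4 * r ^+ 2 / 36].
  have -> : K * w p ^+ 4 * r ^+ 6 / 180 = E (P q4).
    by rewrite unif_mean_poly /q4 /=; field.
  apply: norm_unif_mean_le => // x bx.
  have := taylor4 (phi p) (partial_line p1 x) (partial_line p2 x)
    (partial_line p3 x) (partial_line p4 x) (fun t => M4 (upd x p t)) (x p).
  rewrite upd_self -/(fz f x) -/(fz f1 x) -/(fz f2 x) -/(fz f3 x).
  set y := x p - phi p => H.
  have -> : rho x = (f x - (fz f x + fz f1 x * y + fz f2 x * (y ^+ 2 / 2) +
      fz f3 x * (y ^+ 3 / 6))) * h x.
    rewrite /rho /T /P !big_ord_recr !big_ord0 /= /bump /= -/y /h -/y.
    by rewrite /q0 /q1 /q2 /q3 /=; field.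
  have y4 : `|y| ^+ 4 = y ^+ 4.
    by rewrite (exprM `|y| 2 2) real_normK ?num_real// -exprM.
  have y2r : y ^+ 2 <= r ^+ 2.
    by rewrite -(real_normK (num_real y)) lerXn2r ?nnegrE ?(ltW r0)//; exact: bx.
  have hx : `|h x| <= 2 / 3 * r ^+ 2.
    have := sqr_ge0 y; have := sqr_ge0 r.
    by rewrite /h -/y ler_norml; move: y2r; lra.
  have -> : P q4 x = w p * (w p * (w p * (w p * K))) * `|y| ^+ 4 / 24 *
      (2 / 3 * r ^+ 2).
    rewrite y4 /P !big_ord_recr !big_ord0 /= /bump /= -/y.
    by rewrite /q4 /=; field.
  by rewrite normrM ler_pM.
have Ef2 : `|E (fz f2) - f2 phi| <=
    K * w p ^+ 2 * (\sum_(q < m | q != p) w q ^+ 2) * r ^+ 2 / 6.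
  (* [fz f2] is constant in coordinate [p], so averaging that coordinate costs nothing and the sum
     runs over [q != p] only. *)
  pose M q := if q != p then K * w p ^+ 2 * w q ^+ 2 else 0.
  have -> : K * w p ^+ 2 * (\sum_(q < m | q != p) w q ^+ 2) * r ^+ 2 / 6 =
     (\sum_(q <- enum 'I_m) M q) * r ^+ 2 / 6.
    by rewrite big_enum mulr_sumr -big_mkcond.
  have -> : f2 phi = fz f2 (recenter phi (enum 'I_m) phi).
    congr f2; apply/funext => i; rewrite /upd /recenter mem_enum.
    by case: eqP => [->|].
  apply: dist_box_iter_center => //.
  - exact: enum_uniq.
  - exact: fzL.
  - move=> q _; have [->|qp] := eqVneq q p.
      exists (fun=> 0), (fun=> 0); rewrite /M eqxx; split => [theta|theta|x].
      + by under eq_fun do rewrite fzp; exact: is_derive_cst.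
      + exact: is_derive_cst.
      + by rewrite normr0.
    have [g2 g2E G2] := deriv_bounded_partial q D2.
    have [g3 g3E /deriv_bounded_norm G3] := deriv_bounded_partial q G2.
    exists (fz g2), (fz g3); rewrite /M qp.
    have fzE g g' : partial_at q g g' -> partial_at q (fz g) (fz g').
      move=> gg' theta; have := gg' (upd theta p (phi p)).
      rewrite upd_other//; under eq_fun do rewrite (updC _ _ _ qp).
      by [].
    split; [exact: fzE|exact: fzE|move=> x].
    rewrite (le_trans (G3 _))// le_eqVlt; apply/orP; left; apply/eqP; ring.
  - exact: in_box_center.
have r4 : 0 <= 2 / 45 * r ^+ 4 by rewrite mulr_ge0// exprn_ge0// ltW.
rewrite Efh.
have H1 : `|f2 phi| - K * w p ^+ 2 * (\sum_(q < m | q != p) w q ^+ 2) * r ^+ 2 / 6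
   <= `|E (fz f2)|.
  rewrite lerBlDr; have := ler_normD (E (fz f2)) (f2 phi - E (fz f2)).
  by rewrite addrC subrK distrC; move: Ef2; lra.
have := ler_wpM2l r4 H1.
have : `|2 / 45 * r ^+ 4 * E (fz f2)| - `|E rho| <= `|2 / 45 * r ^+ 4 * E (fz f2) + E rho|.
  by rewrite -[`|E rho|]normrN -[in leRHS](opprK (E rho)) lerB_dist.
rewrite normrM (ger0_norm r4).
have -> : 2 / 45 * r ^+ 4 * (`|f2 phi| - K * w p ^+ 2 *
   (\sum_(q < m | q != p) w q ^+ 2) * r ^+ 2 / 6 - K * w p ^+ 4 * r ^+ 2 / 8) =
   2 / 45 * r ^+ 4 * (`|f2 phi| - K * w p ^+ 2 *
   (\sum_(q < m | q != p) w q ^+ 2) * r ^+ 2 / 6) - K * w p ^+ 4 * r ^+ 6 / 180.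
  by field.
by move: Erho; lra.
Qed.

Lemma unif_var_ge f K : (forall q, 0 <= w q) -> deriv_bounded w 4 K f ->
  let d := cp f phi p
     - K * w p ^+ 2 * (\sum_(q < m | q != p) w q ^+ 2) * r ^+ 2 / 6
     - K * w p ^+ 4 * r ^+ 2 / 8 in
  0 <= d -> r ^+ 4 / 45 * d ^+ 2 <= unif_var phi r f.
Proof.
move=> w0 fD d d0.
have := unif_var_ge_cov (deriv_bounded_lipschitz phi r fD).
apply: le_trans.
have r4 : 0 < r ^+ 4 by rewrite exprn_gt0.
have := cov_quadratic_ge w0 fD; rewrite -/d => H.
rewrite -(real_normK (num_real (E _))).
have -> : r ^+ 4 / 45 * d ^+ 2 =
  45 / (4 * r ^+ 4) * (2 / 45 * r ^+ 4 * d) ^+ 2 by field; rewrite lt0r_neq0.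
rewrite ler_wpM2l ?divr_ge0 ?mulr_ge0 ?(ltW r0)//.
by rewrite lerXn2r ?nnegrE// ?mulr_ge0// ltW.
Qed.

(** This is what later converts [c * (K w^4 r^2)] into [K^2 w^6 r^2]. *)
Lemma cp_le f K : deriv_bounded w 4 K f -> cp f phi p <= K * w p ^+ 2.
Proof.
move=> fD; have [f1 p1 D1] := deriv_bounded_partial p fD.
have [f2 p2 /deriv_bounded_norm D2] := deriv_bounded_partial p D1.
by rewrite (cp_partial p1 p2) (le_trans (D2 _))// mulrA -expr2 mulrC.
Qed.

End VarianceBound.

(** Covers the degenerate cases: a zero radius, and a claimed lower bound that is not positive. *)
Lemma unif_var_ge0 (R : realType) (m : nat) (phi : 'I_m -> R) (r : R) f :
  0 <= r -> 0 <= unif_var phi r f.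
Proof.
move=> r0; rewrite /unif_var {1}/unif_mean.
(* Only the starting point of the iteration is generalised; the centre of the box and the mean stay
   fixed. *)
move: {3}phi => theta; elim: (enum _) theta => [|i s IH] theta; first exact: sqr_ge0.
by apply: avg_ge0 => // t _; exact: IH.
Qed.

(** * Operator bounds for complex matrices *)

Section ComplexParts.
Variable R : realType.
Implicit Types x y : R[i].

Lemma ReD x y : complex.Re (x + y) = complex.Re x + complex.Re y.
Proof. by case: x y => [? ?] []. Qed.

Lemma ImD x y : complex.Im (x + y) = complex.Im x + complex.Im y.
Proof. by case: x y => [? ?] []. Qed.

Lemma ReM x y : complex.Re (x * y) =
  complex.Re x * complex.Re y - complex.Im x * complex.Im y.
Proof. by case: x y => [? ?] []. Qed.

Lemma ImM x y : complex.Im (x * y) =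
  complex.Re x * complex.Im y + complex.Im x * complex.Re y.
Proof. by case: x y => [? ?] []. Qed.

Lemma ReJ x : complex.Re (conjc x) = complex.Re x.
Proof. by case: x. Qed.

Lemma ImJ x : complex.Im (conjc x) = - complex.Im x.
Proof. by case: x. Qed.

Lemma Re_sum (I : Type) (s : seq I) (P : pred I) (F : I -> R[i]) :
  complex.Re (\sum_(i <- s | P i) F i) = \sum_(i <- s | P i) complex.Re (F i).
Proof. by apply: big_morph => //; exact: ReD. Qed.

Lemma Im_sum (I : Type) (s : seq I) (P : pred I) (F : I -> R[i]) :
  complex.Im (\sum_(i <- s | P i) F i) = \sum_(i <- s | P i) complex.Im (F i).
Proof. by apply: big_morph => //; exact: ImD. Qed.

Lemma complex_eq x y :
  complex.Re x = complex.Re y -> complex.Im x = complex.Im y -> x = y.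
Proof. by case: x y => [? ?] [? ?] /= -> ->. Qed.

Lemma sqmodM x y : sqmod (x * y) = sqmod x * sqmod y.
Proof. by rewrite /sqmod ReM ImM; ring. Qed.

Lemma sqmod_ge0 x : 0 <= sqmod x.
Proof. by rewrite addr_ge0// sqr_ge0. Qed.

End ComplexParts.

Section Adjoint.
Variable R : realType.
Local Notation C := (R[i]).

Lemma adjmxE k l (A : 'M[C]_(k, l)) i j : adjmx A i j = conjc (A j i).
Proof. by rewrite !mxE. Qed.

Lemma adjmxM k l n (A : 'M[C]_(k, l)) (B : 'M[C]_(l, n)) :
  adjmx (A *m B) = adjmx B *m adjmx A.
Proof. by rewrite /adjmx map_mxM trmx_mul. Qed.

Lemma adjmxK k l (A : 'M[C]_(k, l)) : adjmx (adjmx A) = A.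
Proof. by apply/matrixP => i j; rewrite !adjmxE conjcK. Qed.

Lemma adjmx1 k : adjmx (1%:M : 'M[C]_k) = 1%:M.
Proof. by rewrite /adjmx map_mx1 trmx1. Qed.

Lemma unitary_adjl k (U : 'M[C]_k) : unitary_mx U -> adjmx U *m U = 1%:M.
Proof. exact: mulmx1C. Qed.

End Adjoint.

Section VectorNorm.
Variables (R : realType) (k : nat).
Local Notation C := (R[i]).
Implicit Types (u v : 'cV[C]_k) (A X U : 'M[C]_k).

(** The Euclidean inner product of the underlying real space of dimension [2 k], enough for norms
    and for real parts of traces. *)
Definition rdot u v : R := complex.Re ((adjmx u *m v) 0 0).

Lemma rdotE u v : rdot u v = \sum_i
  (complex.Re (u i 0) * complex.Re (v i 0) + complex.Im (u i 0) * complex.Im (v i 0)).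
Proof.
rewrite /rdot mxE Re_sum; apply: eq_bigr => i _.
by rewrite adjmxE ReM ReJ ImJ; ring.
Qed.

Lemma rdotDl u u' v : rdot (u + u') v = rdot u v + rdot u' v.
Proof.
rewrite !rdotE -big_split; apply: eq_bigr => i _ /=.
by rewrite mxE ReD ImD; ring.
Qed.

Lemma rdot0l v : rdot 0 v = 0.
Proof. by rewrite rdotE big1// => i _; rewrite mxE !mul0r addr0. Qed.

Lemma rdotC u v : rdot u v = rdot v u.
Proof. by rewrite !rdotE; apply: eq_bigr => i _; ring. Qed.

Lemma rdot_ge0 u : 0 <= rdot u u.
Proof. by rewrite rdotE sumr_ge0// => i _; rewrite addr_ge0// -expr2 sqr_ge0. Qed.

Lemma vnormE u : vnorm u = Num.sqrt (rdot u u).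
Proof. by rewrite rdotE; congr Num.sqrt; apply: eq_bigr => i _; rewrite -!expr2. Qed.

Lemma sqr_vnorm u : vnorm u ^+ 2 = rdot u u.
Proof. by rewrite vnormE sqr_sqrtr// rdot_ge0. Qed.

Lemma vnorm_ge0 u : 0 <= vnorm u.
Proof. exact: sqrtr_ge0. Qed.

Lemma vnorm0_eq0 u : vnorm u = 0 -> u = 0.
Proof.
move=> u0; have : rdot u u = 0 by rewrite -sqr_vnorm u0 expr0n.
rewrite rdotE => /eqP; rewrite psumr_eq0; last first.
  by move=> i _; rewrite addr_ge0// -expr2 sqr_ge0.
move=> /allP H; apply/matrixP => i j; rewrite ord1 mxE.
have := H i (mem_index_enum _); rewrite /= -!expr2 paddr_eq0 ?sqr_ge0//.
by rewrite !sqrf_eq0 => /andP[/eqP Re0 /eqP Im0]; apply: complex_eq.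
Qed.

Lemma rdotZl (a : R) u v : rdot (a%:C%C *: u) v = a * rdot u v.
Proof.
rewrite !rdotE mulr_sumr; apply: eq_bigr => i _.
by rewrite mxE ReM ImM /=; ring.
Qed.

Lemma rdot_le u v : rdot u v <= vnorm u * vnorm v.
Proof.
have [u0|un0] := eqVneq (vnorm u) 0.
  by rewrite u0 (vnorm0_eq0 u0) mul0r rdot0l.
have [v0|vn0] := eqVneq (vnorm v) 0.
  by rewrite v0 (vnorm0_eq0 v0) mulr0 rdotC rdot0l.
have uv : 0 < vnorm u * vnorm v by rewrite mulr_gt0 ?lt0r ?un0 ?vn0 ?vnorm_ge0.
(* The square of this vector expands to [2 |u| |v| (|u| |v| - rdot u v)]. *)
have := rdot_ge0 ((vnorm v)%:C%C *: u + (- vnorm u)%:C%C *: v).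
rewrite rdotDl !rdotZl ![rdot _ (_ + _)]rdotC !rdotDl !rdotZl.
rewrite -!sqr_vnorm [rdot v u]rdotC => H.
rewrite -(ler_pM2l uv) -subr_ge0 -(pmulr_rge0 _ (_ : 0 < 2 :> R))//.
by move: H; congr (0 <= _); ring.
Qed.

Lemma vnorm_le_add u v : vnorm (u + v) <= vnorm u + vnorm v.
Proof.
rewrite -(ler_pXn2r (_ : 0 < 2)%N) ?nnegrE ?addr_ge0 ?vnorm_ge0//.
rewrite sqr_vnorm rdotDl ![rdot _ (_ + _)]rdotC !rdotDl [rdot v u]rdotC.
rewrite -!sqr_vnorm; have := rdot_le u v; move: (rdot u v) => d.
by rewrite sqrrD mulr2n; lra.
Qed.

Lemma vnormZ (z : C) u : vnorm (z *: u) = Num.sqrt (sqmod z) * vnorm u.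
Proof.
rewrite /vnorm -sqrtrM ?sqmod_ge0// mulr_sumr; congr Num.sqrt.
by apply: eq_bigr => i _; rewrite mxE sqmodM.
Qed.

Lemma rdot_mul A u v : rdot (A *m u) v = rdot u (adjmx A *m v).
Proof. by rewrite /rdot adjmxM mulmxA. Qed.

Lemma vnorm_unitary U u : adjmx U *m U = 1%:M -> vnorm (U *m u) = vnorm u.
Proof. by move=> U1; rewrite !vnormE rdot_mul mulmxA U1 mul1mx. Qed.

(** Bounds are propagated instead of [opnorm], which is a [sup] and says something only once the set
    is known to be bounded. *)
Definition opbound A (B : R) := 0 <= B /\ forall v, vnorm (A *m v) <= B * vnorm v.

Lemma opboundD A X a b : opbound A a -> opbound X b -> opbound (A + X) (a + b).
Proof.
move=> [a0 Aa] [b0 Xb]; split=> [|v]; first exact: addr_ge0.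
by rewrite mulmxDl (le_trans (vnorm_le_add _ _))// mulrDl lerD.
Qed.

Lemma opboundM A X a b : opbound A a -> opbound X b -> opbound (A *m X) (a * b).
Proof.
move=> [a0 Aa] [b0 Xb]; split=> [|v]; first exact: mulr_ge0.
by rewrite -mulmxA (le_trans (Aa _))// -mulrA ler_wpM2l.
Qed.

Lemma opbound_unit (z : C) A a : sqmod z = 1 -> opbound A a -> opbound (z *: A) a.
Proof.
by move=> z1 [a0 Aa]; split=> // v; rewrite -scalemxAl vnormZ z1 sqrtr1 mul1r.
Qed.

Lemma opbound_conj U A a : unitary_mx U -> opbound A a ->
  opbound (adjmx U *m A *m U) a.
Proof.
move=> Uu [a0 Aa]; split=> // v.
rewrite -!mulmxA vnorm_unitary ?adjmxK//.
by rewrite (le_trans (Aa _))// vnorm_unitary//; exact: unitary_adjl.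
Qed.

End VectorNorm.

(** * Spectral bounds for Hermitian matrices and density operators *)

Section Hermitian.
Variables (R : realType) (k : nat).
Local Notation C := (R[i]).
Implicit Types (u v : 'cV[C]_k) (A X U P : 'M[C]_k) (d : 'I_k -> C).

Definition diagc d : 'M[C]_k := diag_mx (\row_i d i).

Lemma diagc_mul d n (X : 'M[C]_(k, n)) i j : (diagc d *m X) i j = d i * X i j.
Proof. by rewrite mul_diag_mx !mxE. Qed.

Lemma diagcM d d' : diagc d *m diagc d' = diagc (fun i => d i * d' i).
Proof.
by apply/matrixP => i j; rewrite diagc_mul !mxE mulrnAr.
Qed.

Lemma hermitian_diag A : hermitian_mx A -> exists P (d : 'I_k -> R),
  unitary_mx P /\ A = adjmx P *m diagc (fun i => (d i)%:C%C) *m P.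
Proof.
move=> Ah.
have Ah' : A \is hermsymmx.
  by apply/is_hermitianmxP; rewrite expr0 scale1r -[LHS]Ah /adjmx map_trmx.
have /hermitian_normalmx /orthomx_spectralP AE := Ah'.
have /mxOverP dr := hermitian_spectral_diag_real Ah'.
have Pu : unitary_mx (spectralmx A).
  have /unitarymxP := spectral_unitarymx A.
  by rewrite /unitary_mx /adjmx map_trmx.
exists (spectralmx A), (fun i => complex.Re (spectral_diag A 0 i)); split=> //.
rewrite {1}AE invmx_unitary ?spectral_unitarymx// /diagc.
congr (_ *m diag_mx _ *m _); first by rewrite /adjmx map_trmx.
by apply/matrixP => i j; rewrite !mxE ord1 RRe_real.
Qed.

Lemma opbound_diag (d : 'I_k -> R) b : 0 <= b -> (forall i, `|d i| <= b) ->
  opbound (diagc (fun i => (d i)%:C%C)) b.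
Proof.
move=> b0 db; split=> // v.
rewrite -(ler_pXn2r (_ : 0 < 2)%N) ?nnegrE ?mulr_ge0 ?vnorm_ge0//.
rewrite exprMn /vnorm !sqr_sqrtr; try by rewrite sumr_ge0// => i _; exact: sqmod_ge0.
rewrite mulr_sumr ler_sum// => i _; rewrite diagc_mul sqmodM ler_wpM2r ?sqmod_ge0//.
rewrite /sqmod /= expr0n addr0 -(real_normK (num_real (d i))).
by rewrite lerXn2r ?nnegrE.
Qed.

(** A crude bound whose role is to make the suprema in [opnorm], [lmax] and [lmin] finite. *)
Lemma hermitian_opbound A : hermitian_mx A -> exists b, opbound A b.
Proof.
move=> /hermitian_diag[P [d [Pu ->]]].
exists (\sum_i `|d i|); apply: opbound_conj => //.
apply: opbound_diag => [|i]; first exact: sumr_ge0.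
by rewrite (bigD1 i)//= lerDl sumr_ge0.
Qed.

Lemma opnorm_ge0 A : 0 <= opnorm A.
Proof.
rewrite /opnorm; set E := [set _ | _ in _].
(* A set without supremum has [sup] equal to 0 by convention. *)
have [[[x Ex] uE]|/sup_out->//] := pselect (has_sup E).
apply: le_trans (ub_le_sup uE Ex); case: Ex => v _ <-; exact: vnorm_ge0.
Qed.

Lemma opbound_opnorm A : hermitian_mx A -> opbound A (opnorm A).
Proof.
move=> /hermitian_opbound[b [b0 Ab]]; split; first exact: opnorm_ge0.
move=> v; have [v0|vn0] := eqVneq (vnorm v) 0.
  by rewrite v0 mulr0 (vnorm0_eq0 v0) mulmx0 -(vnorm0_eq0 v0) v0.
have vp : 0 < vnorm v by rewrite lt0r vn0 vnorm_ge0.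
have zn (x : R) : Num.sqrt (sqmod x%:C%C) = `|x|.
  by rewrite /sqmod /= expr0n addr0 sqrtr_sqr.
pose u := ((vnorm v)^-1)%:C%C *: v.
have u1 : vnorm u = 1.
  by rewrite vnormZ zn ger0_norm ?invr_ge0 ?vnorm_ge0// mulVf.
have : vnorm (A *m u) <= opnorm A.
  apply: ub_le_sup; last by exists u.
  by exists b => _ [x /= x1 <-]; rewrite (le_trans (Ab _))// x1 mulr1.
rewrite -scalemxAr vnormZ zn ger0_norm ?invr_ge0 ?vnorm_ge0//.
by rewrite mulrC ler_pdivrMr.
Qed.

Lemma eigenvalue_bound A (a b : R) : hermitian_mx A -> opbound A b ->
  eigenvalue A a%:C%C -> `|a| <= b.
Proof.
move=> Ah [b0 Ab] /eigenvalueP[v vA v0].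
(* [eigenvalue] speaks of row vectors; since [A] is Hermitian and [a] real, the adjoint of [v] is a
   column eigenvector for the same value. *)
have Au : A *m adjmx v = a%:C%C *: adjmx v.
  rewrite -[in LHS]Ah -adjmxM vA; apply/matrixP => i j.
  by rewrite !(adjmxE, mxE) rmorphM /= oppr0.
have un0 : 0 < vnorm (adjmx v).
  rewrite lt0r vnorm_ge0 andbT; apply: contra_neq v0 => /vnorm0_eq0 v0.
  by rewrite -[v]adjmxK v0; apply/matrixP => i j; rewrite adjmxE !mxE conjc0.
have := Ab (adjmx v); rewrite Au vnormZ /sqmod /= expr0n addr0 sqrtr_sqr.
by rewrite ler_pM2r.
Qed.

Lemma diag_eigenvalue P (d : 'I_k -> R) i : unitary_mx P ->
  eigenvalue (adjmx P *m diagc (fun i => (d i)%:C%C) *m P) (d i)%:C%C.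
Proof.
move=> Pu; apply/eigenvalueP; exists (row i P).
  rewrite -row_mul !mulmxA Pu mul1mx; apply/matrixP => a j.
  by rewrite !mxE -(diagc_mul (fun i => (d i)%:C%C)) mxE.
(* A zero row of [P] would contradict the diagonal entry of [P *m adjmx P = 1%:M]. *)
apply: contraTneq isT => ri0.
have := congr1 (fun M : 'M[C]_k => M i i) Pu; rewrite !mxE eqxx big1.
  by move/eqP; rewrite eq_sym oner_eq0.
move=> j _; have := congr1 (fun M : 'rV[C]_k => M 0 j) ri0.
by rewrite !mxE => ->; rewrite mul0r.
Qed.

Lemma eigenvalue_has_sup A : (0 < k)%N -> hermitian_mx A ->
  has_sup [set a : R | eigenvalue A a%:C%C] /\
  has_inf [set a : R | eigenvalue A a%:C%C].
Proof.
move=> k0 Ah; have [b Ab] := hermitian_opbound Ah.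
have ne : [set a : R | eigenvalue A a%:C%C] !=set0.
  have [P [d [Pu AE]]] := hermitian_diag Ah.
  by exists (d (Ordinal k0)); rewrite /= AE; exact: diag_eigenvalue.
split; split=> //; [exists b|exists (- b)] => a /(eigenvalue_bound Ah Ab);
  by rewrite ler_norml => /andP[].
Qed.

Lemma spread_ge0 A : (0 < k)%N -> hermitian_mx A -> 0 <= lmax A - lmin A.
Proof.
move=> k0 Ah; have [[[a aE] uE] [_ lE]] := eigenvalue_has_sup k0 Ah.
by rewrite subr_ge0 (le_trans (ge_inf lE aE))// ub_le_sup.
Qed.

Lemma spread_le A : (0 < k)%N -> hermitian_mx A ->
  lmax A - lmin A <= 2 * opnorm A.
Proof.
move=> k0 Ah; have [[ne uE] [_ lE]] := eigenvalue_has_sup k0 Ah.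
have b a : eigenvalue A a%:C%C -> - opnorm A <= a <= opnorm A.
  by move=> /(eigenvalue_bound Ah (opbound_opnorm Ah)); rewrite ler_norml.
have : lmax A <= opnorm A by apply: ge_sup => // a /b /andP[].
have : - opnorm A <= lmin A by apply: lb_le_inf => // a /b /andP[].
lra.
Qed.

Lemma opbound_centered A : (0 < k)%N -> hermitian_mx A ->
  opbound (A - ((lmax A + lmin A) / 2)%:C%C%:M) ((lmax A - lmin A) / 2).
Proof.
move=> k0 Ah; have [[ne uE] [_ lE]] := eigenvalue_has_sup k0 Ah.
have [P [d [Pu AE]]] := hermitian_diag Ah.
set c := (lmax A + lmin A) / 2.
have -> : A - c%:C%C%:M = adjmx P *m diagc (fun i => (d i - c)%:C%C) *m P.
  have -> : diagc (fun i => (d i - c)%:C%C) =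
      diagc (fun i => (d i)%:C%C) - c%:C%C%:M.
    apply/matrixP => i j; rewrite !mxE -mulrnBl; congr (_ *+ _).
    by apply: complex_eq; rewrite /= ?subr0.
  rewrite mulmxBr mulmxBl -AE; congr (_ - _).
  by rewrite mul_mx_scalar -scalemxAl unitary_adjl// scalemx1.
apply: opbound_conj => //; apply: opbound_diag => [|i].
  by rewrite divr_ge0// spread_ge0.
have di : eigenvalue A (d i)%:C%C by rewrite AE; exact: diag_eigenvalue.
have : d i <= lmax A by apply: ub_le_sup.
have : lmin A <= d i by apply: ge_inf.
by rewrite ler_norml /c; lra.
Qed.

(** In an eigenbasis [u i] of [rho] the trace is a convex combination of the numbers
    [rdot (u i) (X *m u i)], each controlled by Cauchy-Schwarz. *)
Lemma density_trace_le (rho X : 'M[C]_k) b : density_op rho -> opbound X b ->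
  `|complex.Re (\tr (rho *m X))| <= b.
Proof.
move=> [rh rp rt] [b0 Xb].
have [P [d [Pu rE]]] := hermitian_diag rh.
pose u i := adjmx (row i P).
have Pl := unitary_adjl Pu.
have uE i : u i = adjmx P *m delta_mx i 0.
  by rewrite -colE; apply/matrixP => a j; rewrite !mxE.
have u1 i : vnorm (u i) = 1.
  rewrite uE vnorm_unitary ?adjmxK// /vnorm (bigD1 i)//= big1.
    by rewrite mxE !eqxx /sqmod /= expr1n expr0n !addr0 sqrtr1.
  by move=> j /negbTE ji; rewrite mxE ji /sqmod /= expr0n addr0.
have quad (A : 'M[C]_k) i : (P *m A *m adjmx P) i i = (adjmx (u i) *m A *m u i) 0 0.
  rewrite adjmxK -row_mul !mxE; apply: eq_bigr => j _.
  by rewrite !mxE.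
have PrP : P *m rho *m adjmx P = diagc (fun i => (d i)%:C%C).
  by rewrite rE !mulmxA Pu mul1mx -mulmxA Pu mulmx1.
have d0 i : 0 <= d i.
  by have := rp (u i); rewrite -quad PrP !mxE eqxx.
have d1 : \sum_i d i = 1.
  have := congr1 (@complex.Re _) rt.
  rewrite -[rho]mulmx1 -Pl mulmxA mxtrace_mulC mulmxA PrP /= => <-.
  by rewrite Re_sum; apply: eq_bigr => i _; rewrite !mxE eqxx.
have -> : complex.Re (\tr (rho *m X)) = \sum_i d i * rdot (u i) (X *m u i).
  have -> : \tr (rho *m X) =
      \tr (diagc (fun i => (d i)%:C%C) *m (P *m X *m adjmx P)).
    by rewrite rE -!mulmxA mxtrace_mulC !mulmxA.
  rewrite Re_sum.
  apply: eq_bigr => i _; rewrite diagc_mul quad ReM /= mul0r subr0.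
  by rewrite /rdot mulmxA.
rewrite (le_trans (ler_norm_sum _ _ _))// -[leRHS]mul1r -d1 mulr_suml ler_sum// => i _.
rewrite normrM (ger0_norm (d0 i)) ler_wpM2l//.
have H v : vnorm v = 1 -> rdot v (X *m u i) <= b.
  by move=> v1; rewrite (le_trans (rdot_le _ _))// v1 mul1r (le_trans (Xb _))// u1 mulr1.
rewrite ler_norml lerNl H// andbT.
have -> : - rdot (u i) (X *m u i) = rdot ((-1)%:C%C *: u i) (X *m u i).
  by rewrite rdotZl mulN1r.
by apply: H; rewrite vnormZ /sqmod /= expr0n addr0 sqrrN expr1n sqrtr1 mul1r.
Qed.

End Hermitian.

(** * Unitary evolution *)

Section Exponential.
Variable R : realType.
Local Notation C := (R[i]).

(** The number [e^(-ix)], with the sign convention of [evol]. *)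
Definition cis (x : R) : C := (cos x -i* sin x)%C.

Lemma Re_invfact n (z : C) : complex.Re ((n`!%:R)^-1 * z) = complex.Re z / n`!%:R.
Proof.
by rewrite -(rmorph_nat (real_complex R)) -fmorphV ReM /= mul0r subr0 mulrC.
Qed.

Lemma Im_invfact n (z : C) : complex.Im ((n`!%:R)^-1 * z) = complex.Im z / n`!%:R.
Proof.
by rewrite -(rmorph_nat (real_complex R)) -fmorphV ImM /= mul0r addr0 mulrC.
Qed.

Lemma exp_imaginary (x : R) n :
  complex.Re ((- (x *i))%C ^+ n) = (~~ odd n)%:R * (-1) ^+ n./2 * x ^+ n /\
  complex.Im ((- (x *i))%C ^+ n) = - ((odd n)%:R * (-1) ^+ n.-1./2 * x ^+ n).
Proof.
set z := (- _)%C.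
have zz : z * z = (- x ^+ 2)%:C%C.
  by apply: complex_eq; rewrite ?ReM ?ImM /=; ring.
have step j : complex.Re (z ^+ j.+2) = - x ^+ 2 * complex.Re (z ^+ j) /\
    complex.Im (z ^+ j.+2) = - x ^+ 2 * complex.Im (z ^+ j).
  by rewrite !(exprS z) mulrA zz ReM ImM /= !mul0r subr0 addr0; split.
(* The recursion [z^(n+2) = - x^2 z^n] has step two, so the induction carries two consecutive
   exponents. The right-hand sides are shaped after [cos_coeff] and [sin_coeff]. *)
suff [] : (complex.Re (z ^+ n) = (~~ odd n)%:R * (-1) ^+ n./2 * x ^+ n /\
    complex.Im (z ^+ n) = - ((odd n)%:R * (-1) ^+ n.-1./2 * x ^+ n)) /\
   (complex.Re (z ^+ n.+1) = (~~ odd n.+1)%:R * (-1) ^+ n.+1./2 * x ^+ n.+1 /\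
    complex.Im (z ^+ n.+1) = - ((odd n.+1)%:R * (-1) ^+ n./2 * x ^+ n.+1)) by [].
elim: n => [|n [[IH1 IH2] [IH3 IH4]]].
  by rewrite expr0 expr1 /=; split; split; ring.
split; first by [].
have [-> ->] := step n; rewrite IH1 IH2 negbK /=.
split; first by rewrite !exprS; ring.
case: n {IH1 IH2 IH3 IH4} => [|n] /=; first by rewrite !mul0r oppr0 mulr0.
rewrite negbK; case: (boolP (odd n)) => on; rewrite /= ?mul0r ?oppr0 ?mulr0//.
by rewrite !exprS; ring.
Qed.

Definition expc_partial (z : C) N := \sum_(j < N) (j`!%:R)^-1 * z ^+ j.

Lemma expc_partial_cvg (x : R) :
  (fun N => complex.Re (expc_partial (- (x *i))%C N)) @ \oo --> cos x /\
  (fun N => complex.Im (expc_partial (- (x *i))%C N)) @ \oo --> - sin x.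
Proof.
have -> : (fun N => complex.Re (expc_partial (- (x *i))%C N)) = series (cos_coeff x).
  apply/funext => N; rewrite /series /= big_mkord Re_sum; apply: eq_bigr => j _.
  by rewrite Re_invfact (exp_imaginary x j).1.
have -> : (fun N => complex.Im (expc_partial (- (x *i))%C N)) =
    - series (sin_coeff x).
  apply/funext => N; rewrite fctE /series /= big_mkord Im_sum -sumrN.
  by apply: eq_bigr => j _; rewrite Im_invfact (exp_imaginary x j).2 mulNr.
split; first by rewrite unlock; exact: is_cvg_series_cos_coeff.
by apply: cvgN; rewrite unlock; exact: is_cvg_series_sin_coeff.
Qed.

Variable k : nat.
Implicit Types (P H : 'M[C]_k) (d : 'I_k -> R).

Lemma conj_diagE P (s : 'I_k -> C) a b : (adjmx P *m diagc s *m P) a b =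
  \sum_i conjc (P i a) * P i b * s i.
Proof.
rewrite -mulmxA mxE; apply: eq_bigr => i _.
by rewrite adjmxE diagc_mul; ring.
Qed.

Lemma mxpow_diag P (s : 'I_k -> C) j : unitary_mx P ->
  mxpow (adjmx P *m diagc s *m P) j = adjmx P *m diagc (fun i => s i ^+ j) *m P.
Proof.
move=> Pu; elim: j => [|j IH].
  have -> : diagc (fun i => s i ^+ 0) = 1%:M.
    by apply/matrixP => a b; rewrite !mxE expr0.
  by rewrite mulmx1 unitary_adjl.
rewrite /mxpow iterS -/(mxpow _ j) IH !mulmxA -[_ *m P *m adjmx P]mulmxA Pu mulmx1.
rewrite -[_ *m diagc _ *m diagc _]mulmxA diagcM.
by congr (_ *m diagc _ *m _); apply/funext => i; rewrite exprS.
Qed.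

Lemma expm_partial_diag P (s : 'I_k -> C) N : unitary_mx P ->
  expm_partial (adjmx P *m diagc s *m P) N =
  adjmx P *m diagc (fun i => expc_partial (s i) N) *m P.
Proof.
move=> Pu; apply/matrixP => a b; rewrite conj_diagE summxE.
under eq_bigr => j _ do rewrite mxpow_diag// mxE conj_diagE mulr_sumr.
rewrite exchange_big /=; apply: eq_bigr => i _.
by rewrite mulr_sumr; apply: eq_bigr => j _; ring.
Qed.

Lemma cvg_sum_nat (I : finType) (F : I -> nat -> R) (l : I -> R) :
  (forall i, F i @ \oo --> l i) ->
  (fun N => \sum_i F i N) @ \oo --> \sum_i l i.
Proof.
move=> Fl; rewrite -fct_sumE; elim/big_ind2 : _ => //.
  exact: cvg_cst.
by move=> u a v b ua vb; exact: cvgD.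
Qed.

(** In an eigenbasis each entry of the partial sums is a finite combination of scalar exponential
    series, so the entrywise limits defining [expm] reduce to those of cosine and sine. *)
Lemma evol_diag P d (t : R) : unitary_mx P ->
  evol t (adjmx P *m diagc (fun i => (d i)%:C%C) *m P) =
  adjmx P *m diagc (fun i => cis (t * d i)) *m P.
Proof.
move=> Pu; rewrite /evol.
have -> : (- (t *i))%C *: (adjmx P *m diagc (fun i => (d i)%:C%C) *m P) =
    adjmx P *m diagc (fun i => (- ((t * d i) *i))%C) *m P.
  apply/matrixP => a b; rewrite mxE !conj_diagE mulr_sumr; apply: eq_bigr => i _.
  have -> : (- ((t * d i) *i))%C = (- (t *i))%C * (d i)%:C%C.
    by apply: complex_eq; rewrite ?ReM ?ImM /=; ring.
  by ring.
apply/matrixP => a b; rewrite mxE conj_diagE.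
apply: complex_eq; rewrite /= ?Re_sum ?Im_sum; apply: cvg_lim => //.
  under eq_fun => N do rewrite expm_partial_diag// conj_diagE Re_sum.
  apply: cvg_sum_nat => i.
  under eq_fun => N do rewrite ReM.
  have [cr ci] := expc_partial_cvg (t * d i).
  by rewrite ReM; apply: cvgB; apply: cvgMr.
under eq_fun => N do rewrite expm_partial_diag// conj_diagE Im_sum.
apply: cvg_sum_nat => i.
under eq_fun => N do rewrite ImM.
have [cr ci] := expc_partial_cvg (t * d i).
by rewrite ImM; apply: cvgD; apply: cvgMr.
Qed.

Lemma evol_unitary H t : hermitian_mx H -> unitary_mx (evol t H).
Proof.
move=> /hermitian_diag[P [d [Pu ->]]]; rewrite evol_diag// /unitary_mx.
rewrite !adjmxM adjmxK !mulmxA -[_ *m P *m adjmx P]mulmxA Pu mulmx1.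
rewrite -[X in X *m P]mulmxA.
have -> : diagc (fun i => cis (t * d i)) *m adjmx (diagc (fun i => cis (t * d i)))
    = 1%:M.
  apply/matrixP => i j; rewrite diagc_mul adjmxE !mxE eq_sym.
  case: eqP => [->|_]; last by rewrite mulr0n conjc0 mulr0.
  rewrite !mulr1n; apply: complex_eq; rewrite ?ReM ?ImM /=; last by ring.
  by rewrite -(cos2Dsin2 (t * d j)); ring.
by rewrite mulmx1 unitary_adjl.
Qed.

End Exponential.

(** * Heisenberg evolution and the loss *)

Section MatrixDerivative.
Variables (R : realType) (k : nat).
Local Notation C := (R[i]).
Implicit Types (F G : R -> 'M[C]_k) (D A X H : 'M[C]_k) (t : R).

Definition cderiv (f : R -> C) t (d : C) :=
  is_derive t 1 (fun s => complex.Re (f s)) (complex.Re d) /\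
  is_derive t 1 (fun s => complex.Im (f s)) (complex.Im d).

Definition mxderiv F t D := forall i j, cderiv (fun s => F s i j) t (D i j).

Lemma eq_mxderiv F G t D D' : mxderiv F t D -> F =1 G -> D = D' -> mxderiv G t D'.
Proof. by move=> FD /funext <- <-. Qed.

Lemma cderivD f g t (a b : C) : cderiv f t a -> cderiv g t b ->
  cderiv (fun s => f s + g s) t (a + b).
Proof.
move=> [fR fI] [gR gI]; split.
  by rewrite ReD; under eq_fun do rewrite ReD; exact: is_deriveD.
by rewrite ImD; under eq_fun do rewrite ImD; exact: is_deriveD.
Qed.

Lemma cderivM f g t (a b : C) : cderiv f t a -> cderiv g t b ->
  cderiv (fun s => f s * g s) t (a * g t + f t * b).
Proof.
move=> [fR fI] [gR gI]; split.
  under eq_fun do rewrite ReM.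
  refine (is_derive_eq (is_deriveB (is_deriveM fR gR) (is_deriveM fI gI)) _).
  by rewrite ReD !ReM !scale_mul; ring.
under eq_fun do rewrite ImM.
refine (is_derive_eq (is_deriveD (is_deriveM fR gI) (is_deriveM fI gR)) _).
by rewrite ImD !ImM !scale_mul; ring.
Qed.

Lemma cderiv_cst (c : C) t : cderiv (fun=> c) t 0.
Proof. by split; exact: is_derive_cst. Qed.

Lemma cderiv_sum n (f : 'I_n -> R -> C) t (a : 'I_n -> C) :
  (forall i, cderiv (f i) t (a i)) ->
  cderiv (fun s => \sum_i f i s) t (\sum_i a i).
Proof.
move=> fa; rewrite (_ : (fun s => _) = \sum_i f i); last first.
  by apply/funext => s; rewrite fct_sumE.
elim/big_ind2 : _ => // [|g b g' b']; first exact: cderiv_cst.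
exact: cderivD.
Qed.

Lemma mxderiv_cst A t : mxderiv (fun=> A) t 0.
Proof. by move=> i j; rewrite mxE; exact: cderiv_cst. Qed.

Lemma mxderivD F G t D D' : mxderiv F t D -> mxderiv G t D' ->
  mxderiv (fun s => F s + G s) t (D + D').
Proof.
move=> FD GD i j; rewrite mxE; under eq_fun do rewrite mxE.
exact: cderivD.
Qed.

Lemma mxderivM F G t D D' : mxderiv F t D -> mxderiv G t D' ->
  mxderiv (fun s => F s *m G s) t (D *m G t + F t *m D').
Proof.
move=> FD GD i j; rewrite !mxE -big_split; under eq_fun do rewrite mxE.
by apply: cderiv_sum => a; exact: cderivM.
Qed.

Lemma mxderiv_adj F t D : mxderiv F t D -> mxderiv (fun s => adjmx (F s)) t (adjmx D).
Proof.
move=> FD i j; have [dR dI] := FD j i; rewrite adjmxE.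
split; under eq_fun do rewrite adjmxE.
  by rewrite ReJ; under eq_fun do rewrite ReJ.
by rewrite ImJ; under eq_fun do rewrite ImJ; exact: is_deriveN.
Qed.

Lemma cderiv_cis (a t : R) :
  cderiv (fun s => cis (s * a)) t ((- 'i)%C * a%:C%C * cis (t * a)).
Proof.
have sa : is_derive t 1 (fun s : R => s * a) a.
  have -> : (fun s : R => s * a) = a \*: (id : R -> R).
    by apply/funext => s; rewrite mulrC.
  by apply: is_derive_eq (_ : a *: 1 = a); rewrite scale_mul mulr1.
split.
  have := @is_derive1_comp _ cos (fun s => s * a) t _ _ (is_derive_cos _) sa.
  by move=> h; refine (is_derive_eq h _); rewrite !ReM ?ImM /=; ring.
have := @is_derive1_comp _ sin (fun s => s * a) t _ _ (is_derive_sin _) sa.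
move=> h; refine (is_derive_eq (is_deriveN h) _).
by rewrite !ImM ?ReM ?ImM /=; ring.
Qed.

Lemma mxderiv_evol H t : hermitian_mx H ->
  mxderiv (fun s => evol s H) t ((- 'i)%C *: H *m evol t H).
Proof.
move=> /hermitian_diag[P [d [Pu ->]]].
under eq_fun do rewrite evol_diag//.
pose s t i := cis (t * d i); rewrite evol_diag//.
have ds : mxderiv (fun t => diagc (s t)) t
    (diagc (fun i => (- 'i)%C * (d i)%:C%C * s t i)).
  move=> i j; rewrite !mxE; under eq_fun do rewrite !mxE.
  case: eqP => _; last exact: cderiv_cst.
  by rewrite mulr1n; under eq_fun do rewrite mulr1n; exact: cderiv_cis.
have := mxderivM (mxderivM (mxderiv_cst (adjmx P) t) ds) (mxderiv_cst P t).
rewrite mulmx0 addr0 mul0mx add0r -!scalemxAl !mulmxA.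
rewrite -[_ *m P *m adjmx P]mulmxA Pu mulmx1 -[_ *m diagc _ *m diagc _]mulmxA diagcM.
suff -> : diagc (fun i => (- 'i)%C * (d i)%:C%C * s t i) =
    (- 'i)%C *: diagc (fun i => (d i)%:C%C * s t i).
  by rewrite -scalemxAr -scalemxAl.
by apply/matrixP => i j; rewrite !mxE mulrnAr mulrA.
Qed.

(** The derivative is again a conjugate by [evol t H], so the rule can be iterated. The shift [c] is
    free because its contributions [i c F] and [- i c F] cancel. *)
Lemma mxderiv_heisenberg F H (c : R) t D : hermitian_mx H -> mxderiv F t D ->
  mxderiv (fun s => adjmx (evol s H) *m F s *m evol s H) t
    (adjmx (evol t H) *m (D + ('i%C *: (H - c%:C%C%:M)) *m F t
       + F t *m ((- 'i)%C *: (H - c%:C%C%:M))) *m evol t H).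
Proof.
move=> Hh FD; have dE := mxderiv_evol t Hh.
have := mxderivM (mxderivM (mxderiv_adj dE) FD) dE.
set E := evol t H.
suff -> : adjmx E *m (D + 'i%C *: (H - c%:C%C%:M) *m F t +
      F t *m ((- 'i)%C *: (H - c%:C%C%:M))) *m E =
   (adjmx ((- 'i)%C *: H *m E) *m F t + adjmx E *m D) *m E +
   adjmx E *m F t *m ((- 'i)%C *: H *m E) by [].
have -> : adjmx ((- 'i)%C *: H *m E) = adjmx E *m ('i%C *: H).
  rewrite adjmxM -[in RHS]Hh; congr (_ *m _); apply/matrixP => i j.
  by rewrite !(adjmxE, mxE) rmorphM /= oppr0 opprK.
have -> : D + 'i%C *: (H - c%:C%C%:M) *m F t + F t *m ((- 'i)%C *: (H - c%:C%C%:M)) =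
   ('i%C *: H) *m F t + D + F t *m ((- 'i)%C *: H).
  rewrite !scalerBr mulmxBl mulmxBr -!scalemxAl -!scalemxAr.
  rewrite mul_scalar_mx mul_mx_scalar.
  have -> : (- 'i)%C *: (c%:C%C *: F t) = - ('i%C *: (c%:C%C *: F t)).
    by rewrite -scaleNr.
  rewrite opprK; set a := 'i%C *: (_ *m _); set b := 'i%C *: (_ *: _).
  set e := (- 'i)%C *: _.
  by rewrite [e + b]addrC addrA -[D + _ + b]addrA subrK [a + D]addrC.
by rewrite !(mulmxDr, mulmxDl) !mulmxA.
Qed.

Lemma is_derive_trace (rho : 'M[C]_k) F t D : mxderiv F t D ->
  is_derive t 1 (fun s => complex.Re (\tr (rho *m F s))) (complex.Re (\tr (rho *m D))).
Proof.
move=> FD; have := mxderivM (mxderiv_cst rho t) FD; rewrite mul0mx add0r => H.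
by have [] := cderiv_sum (fun i => H i i).
Qed.

End MatrixDerivative.

(** * Derivative bounds for Heisenberg-evolved observables *)

Section MatrixControlled.
Variables (R : realType) (m k : nat).
Local Notation C := (R[i]).
Implicit Types (F G : ('I_m -> R) -> 'M[C]_k) (A H V : 'M[C]_k)
  (w : 'I_m -> R) (p q : 'I_m) (theta : 'I_m -> R).

Definition mxpartial_at q F G := forall theta,
  mxderiv (fun t => F (upd theta q t)) (theta q) (G theta).

Fixpoint mx_deriv_bounded w (n : nat) (B : R) F : Prop :=
  (forall theta, opbound (F theta) B) /\
  if n is n'.+1 then
    forall q, exists2 G, mxpartial_at q F G & mx_deriv_bounded w n' (w q * B) G
  else True.

Lemma mx_deriv_bounded_opbound w n B F : mx_deriv_bounded w n B F ->
  forall theta, opbound (F theta) B.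
Proof. by case: n => [|n] []. Qed.

Lemma mx_deriv_bounded_pred w n B F : mx_deriv_bounded w n.+1 B F ->
  mx_deriv_bounded w n B F.
Proof.
elim: n B F => [|n IH] B F; first by case.
move=> [FB FD]; split=> // q; have [G FG GD] := FD q.
by exists G => //; exact: IH.
Qed.

Lemma mx_deriv_boundedD w n B B' F G :
  mx_deriv_bounded w n B F -> mx_deriv_bounded w n B' G ->
  mx_deriv_bounded w n (B + B') (fun theta => F theta + G theta).
Proof.
elim: n B B' F G => [|n IH] B B' F G [FB FD] [GB GD].
  by split=> // theta; exact: opboundD.
split=> [theta|q]; first exact: opboundD.
have [F' FF' F'D] := FD q; have [G' GG' G'D] := GD q.
exists (fun theta => F' theta + G' theta); first by move=> theta; exact: mxderivD.
by rewrite mulrDr; exact: IH.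
Qed.

Lemma mx_deriv_bounded_mull w n A a B F : opbound A a ->
  mx_deriv_bounded w n B F -> mx_deriv_bounded w n (a * B) (fun theta => A *m F theta).
Proof.
move=> Aa; elim: n B F => [|n IH] B F [FB FD].
  by split=> // theta; exact: opboundM.
split=> [theta|q]; first exact: opboundM.
have [G FG GD] := FD q; exists (fun theta => A *m G theta); last first.
  by rewrite mulrCA; exact: IH.
move=> theta; have := mxderivM (mxderiv_cst A (theta q)) (FG theta).
by rewrite mul0mx add0r.
Qed.

Lemma mx_deriv_bounded_mulr w n A a B F : opbound A a ->
  mx_deriv_bounded w n B F -> mx_deriv_bounded w n (B * a) (fun theta => F theta *m A).
Proof.
move=> Aa; elim: n B F => [|n IH] B F [FB FD].
  by split=> // theta; exact: opboundM.
split=> [theta|q]; first exact: opboundM.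
have [G FG GD] := FD q; exists (fun theta => G theta *m A); last first.
  by rewrite mulrA; exact: IH.
move=> theta; have := mxderivM (FG theta) (mxderiv_cst A (theta q)).
by rewrite mulmx0 addr0.
Qed.

Lemma opbound_unitary V : unitary_mx V -> opbound V 1.
Proof.
by move=> Vu; split=> // v; rewrite vnorm_unitary ?mul1r//; exact: unitary_adjl.
Qed.

Lemma mx_deriv_bounded_conj w n V B F : unitary_mx V ->
  mx_deriv_bounded w n B F ->
  mx_deriv_bounded w n B (fun theta => adjmx V *m F theta *m V).
Proof.
move=> Vu FD; have Vo := opbound_unitary Vu.
have Vo' : opbound (adjmx V) 1.
  by apply: opbound_unitary; rewrite /unitary_mx adjmxK; exact: unitary_adjl.
by rewrite -[B]mul1r -[1 * B]mulr1; apply: mx_deriv_bounded_mulr => //;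
  exact: mx_deriv_bounded_mull.
Qed.

Lemma mx_deriv_bounded_cst w n A B : (forall q, 0 <= w q) -> opbound A B ->
  mx_deriv_bounded w n B (fun=> A).
Proof.
move=> w0; elim: n A B => [|n IH] A B AB; split=> // q.
exists (fun=> 0); first by move=> theta; exact: mxderiv_cst.
apply: IH; split; first by rewrite mulr_ge0//; case: AB.
move=> v; rewrite mul0mx vnormE rdot0l sqrtr0 !mulr_ge0 ?vnorm_ge0//.
by case: AB.
Qed.

(** Only the weight of [p] grows: differentiating [F] contributes [w p * B], and each half of the
    commutator contributes [s / 2 * B]. *)
Lemma mx_deriv_bounded_heisenberg w n p H (c s : R) B F :
  hermitian_mx H -> opbound (H - c%:C%C%:M) (s / 2) ->
  mx_deriv_bounded w n B F ->
  mx_deriv_bounded (fun q => w q + (if p == q then s else 0)) n B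
    (fun theta => adjmx (evol (theta p) H) *m F theta *m evol (theta p) H).
Proof.
move=> Hh Hs; elim: n B F => [|n IH] B F FD.
  split=> // theta; apply: opbound_conj; first exact: evol_unitary.
  exact: mx_deriv_bounded_opbound FD _.
(* The commutator terms contain [F] itself, of which [n] further derivatives remain to be
   controlled. *)
have FD' := mx_deriv_bounded_pred FD.
split=> [theta|q].
  apply: opbound_conj; first exact: evol_unitary.
  exact: mx_deriv_bounded_opbound FD _.
have [G FG GD] := FD.2 q.
have [pq|pq] := eqVneq p q; last first.
  exists (fun theta => adjmx (evol (theta p) H) *m G theta *m evol (theta p) H).
    move=> theta.
    have E := mxderiv_cst (evol (theta p) H) (theta q).
    have := mxderivM (mxderivM (mxderiv_adj E) (FG theta)) E.
    rewrite mulmx0 addr0 upd_self (_ : adjmx 0 = 0); last first.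
      by apply/matrixP => i j; rewrite adjmxE !mxE conjc0.
    rewrite mul0mx add0r; under [in X in _ -> X]eq_fun do rewrite upd_other//.
    by [].
  by rewrite addr0; exact: IH.
rewrite -pq in FG GD *; exists (fun theta => adjmx (evol (theta p) H) *m
   (G theta + ('i%C *: (H - c%:C%C%:M)) *m F theta
       + F theta *m ((- 'i)%C *: (H - c%:C%C%:M))) *m evol (theta p) H).
  move=> theta; refine (eq_mxderiv (mxderiv_heisenberg c Hh (FG theta)) _ _).
    by move=> t; rewrite upd_same.
  by rewrite upd_self.
apply: IH.
have -> : (w p + s) * B = w p * B + s / 2 * B + B * (s / 2) by field.
have i1 : sqmod ('i%C : C) = 1 by rewrite /sqmod /= expr1n expr0n add0r.
have i2 : sqmod ((- 'i)%C : C) = 1.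
  by rewrite /sqmod /= oppr0 expr0n sqrrN expr1n add0r.
apply: mx_deriv_boundedD; first apply: mx_deriv_boundedD => //.
  exact: (mx_deriv_bounded_mull (opbound_unit i1 Hs) FD').
exact: (mx_deriv_bounded_mulr (opbound_unit i2 Hs) FD').
Qed.

Lemma trace_deriv_bounded w n B F (rho : 'M[C]_k) : density_op rho ->
  mx_deriv_bounded w n B F ->
  deriv_bounded w n B (fun theta => complex.Re (\tr (rho *m F theta))).
Proof.
move=> rd; elim: n B F => [|n IH] B F [FB FD].
  by split=> // theta; exact: density_trace_le.
split=> [theta|q]; first exact: density_trace_le.
have [G FG GD] := FD q; exists (fun theta => complex.Re (\tr (rho *m G theta))).
  by move=> theta; exact: is_derive_trace.
exact: IH.
Qed.

Section Circuit.
Variables (M : nat) (S : 'I_M -> 'I_m) (V H : 'I_M -> 'M[C]_k).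
Hypotheses (k0 : (0 < k)%N) (Vu : forall l, unitary_mx (V l))
  (Hh : forall l, hermitian_mx (H l)).

(** The leftmost gate of [U] is the one next to [F] in the conjugate, so peeling it off replaces [F]
    by its conjugate and raises [w]; both must vary in the induction. A shared parameter collects
    the spreads of all its generators. *)
Lemma mx_deriv_bounded_circuit (ls : seq 'I_M) w n B F :
  mx_deriv_bounded w n B F ->
  let U theta := foldr (fun l acc => V l *m evol (theta (S l)) (H l) *m acc) 1%:M ls in
  mx_deriv_bounded
    (fun q => w q + \sum_(l <- ls | S l == q) (lmax (H l) - lmin (H l))) n B
    (fun theta => adjmx (U theta) *m F theta *m U theta).
Proof.
elim: ls w F => [|l ls IH] w F FD U.
  rewrite (_ : (fun q => _) = w); last by apply/funext => q; rewrite big_nil addr0.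
  rewrite (_ : (fun theta => _) = F)//.
  by apply/funext => theta; rewrite /U /= adjmx1 mul1mx mulmx1.
have := IH _ _ (mx_deriv_bounded_heisenberg (S l) (Hh l) (opbound_centered k0 (Hh l))
   (mx_deriv_bounded_conj (Vu l) FD)).
rewrite [X in mx_deriv_bounded X](_ : _ =
   fun q => w q + \sum_(l <- l :: ls | S l == q) (lmax (H l) - lmin (H l))); last first.
  by apply/funext => q; rewrite big_cons -addrA; case: eqP; rewrite ?add0r.
rewrite [X in mx_deriv_bounded _ _ _ X -> _](_ : _ =
  fun theta => adjmx (U theta) *m F theta *m U theta)//.
by apply/funext => theta; rewrite /U /= !adjmxM !mulmxA.
Qed.

(** Cyclicity of the trace moves the circuit onto the observable, which starts as the constant [O]
    with all weights zero. *)
Lemma loss_deriv_bounded n (rho O : 'M[C]_k) : density_op rho -> hermitian_mx O ->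
  deriv_bounded (omega_max S H) n (opnorm O) (loss S V H rho O).
Proof.
move=> rd Oh.
have := trace_deriv_bounded rd (mx_deriv_bounded_circuit (enum 'I_M)
  (mx_deriv_bounded_cst (w := fun=> 0) n (fun=> lexx _) (opbound_opnorm Oh))).
rewrite [X in deriv_bounded X](_ : _ = omega_max S H); last first.
  by apply/funext => q; rewrite add0r big_enum_cond.
rewrite [X in deriv_bounded _ _ _ X -> _](_ : _ = loss S V H rho O)//.
apply/funext => theta; rewrite /loss /circuit; set U := foldr _ _ _.
by rewrite -!mulmxA [in RHS]mxtrace_mulC !mulmxA.
Qed.

Lemma omega_max_ge0 q : 0 <= omega_max S H q.
Proof. by apply: sumr_ge0 => l _; exact: spread_ge0. Qed.

End Circuit.

End MatrixControlled.

(** * The patch radius *)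

Section PatchArithmetic.
Variable R : realType.
Implicit Types (c K w A r Q v : R).

Definition patch_radius2 c K w A : R :=
  9 * c ^+ 2 / (8 * (16 * c * K * w ^+ 2 * A + 32 * K ^+ 2 * w ^+ 6)).

Lemma patch_denom_ge0 c K w A : 0 <= c -> 0 <= K -> 0 <= w -> 0 <= A ->
  0 <= 8 * (16 * c * K * w ^+ 2 * A + 32 * K ^+ 2 * w ^+ 6).
Proof.
by move=> c0 K0 w0 A0; apply: mulr_ge0 => //; apply: addr_ge0; rewrite !mulr_ge0.
Qed.

(** Division by zero yields 0, so a positive [r] below the radius forces a nonzero denominator and a
    nonzero [c]; the inequality is the hypothesis with the denominator cleared. *)
Lemma patch_radiusP c K w A r : 0 <= c -> 0 <= K -> 0 <= w -> 0 <= A -> 0 < r ->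
  r ^+ 2 <= patch_radius2 c K w A ->
  0 < c /\ 128 * (c * (K * w ^+ 2 * A * r ^+ 2)) + 256 * (K ^+ 2 * w ^+ 6 * r ^+ 2)
    <= 9 * c ^+ 2.
Proof.
move=> c0 K0 w0 A0 r0; rewrite /patch_radius2; set D := 8 * _ => rD.
have r2 : 0 < r ^+ 2 by rewrite exprn_gt0.
have D0 : 0 < D.
  rewrite lt0r patch_denom_ge0// andbT; apply: contraTneq rD => ->.
  by rewrite invr0 mulr0 -ltNge.
have := rD; rewrite ler_pdivlMr// => H; split; last first.
  by move: H; rewrite /D; congr (_ <= _); ring.
rewrite lt0r c0 andbT; apply: contraTneq H => ->.
by rewrite expr0n mulr0 -ltNge mulr_gt0.
Qed.

(** The hypothesis divided by 24 bounds the two negative terms by [3/8 c^2]; the remaining [5/8],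
    divided by 45, is the constant [1/72]. *)
Lemma patch_main_term c K w A r :
  128 * (c * (K * w ^+ 2 * A * r ^+ 2)) + 256 * (K ^+ 2 * w ^+ 6 * r ^+ 2)
    <= 9 * c ^+ 2 ->
  5 / 8 * c ^+ 2 <= (c - 8 / 3 * K * w ^+ 2 * A * r ^+ 2) ^+ 2
                      - 32 / 3 * K ^+ 2 * w ^+ 6 * r ^+ 2.
Proof.
set x := K * w ^+ 2 * A * r ^+ 2; set y := K ^+ 2 * w ^+ 6 * r ^+ 2 => H.
have -> : 8 / 3 * K * w ^+ 2 * A * r ^+ 2 = 8 / 3 * x by rewrite /x; ring.
have -> : 32 / 3 * K ^+ 2 * w ^+ 6 * r ^+ 2 = 32 / 3 * y by rewrite /y; ring.
have -> : (c - 8 / 3 * x) ^+ 2 = c ^+ 2 - 16 / 3 * (c * x) + 64 / 9 * x ^+ 2 by field.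
by have := sqr_ge0 x; lra.
Qed.

(** One has [d >= c' - e], and the cross term of [(c' - e)^2] is at most [2 c e <= y / 4], below the
    allowed [32/3 y]. If [e > c'], then [c'^2 <= c' e <= y / 8] and the claimed lower bound is not
    positive. *)
Lemma patch_lower_term c K w A r v :
  0 < c -> 0 <= K -> 0 <= w -> 0 <= A -> 0 <= r -> c <= K * w ^+ 2 ->
  128 * (c * (K * w ^+ 2 * A * r ^+ 2)) + 256 * (K ^+ 2 * w ^+ 6 * r ^+ 2)
    <= 9 * c ^+ 2 ->
  0 <= v ->
  (let d := c - K * w ^+ 2 * A * r ^+ 2 / 6 - K * w ^+ 4 * r ^+ 2 / 8 in
   0 <= d -> r ^+ 4 / 45 * d ^+ 2 <= v) ->
  r ^+ 4 / 45 * ((c - 8 / 3 * K * w ^+ 2 * A * r ^+ 2) ^+ 2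
                      - 32 / 3 * K ^+ 2 * w ^+ 6 * r ^+ 2) <= v.
Proof.
move=> c0 K0 w0 A0 r0 cK.
set x := K * w ^+ 2 * A * r ^+ 2; set y := K ^+ 2 * w ^+ 6 * r ^+ 2 => H v0 dv.
have -> : 8 / 3 * K * w ^+ 2 * A * r ^+ 2 = 8 / 3 * x by rewrite /x; ring.
have -> : 32 / 3 * K ^+ 2 * w ^+ 6 * r ^+ 2 = 32 / 3 * y by rewrite /y; ring.
have x0 : 0 <= x by rewrite !mulr_ge0.
have y0 : 0 <= y by rewrite !mulr_ge0.
have r4 : 0 <= r ^+ 4 / 45.
  by rewrite divr_ge0// (exprM r 2 2) sqr_ge0.
move: dv; set e := K * w ^+ 4 * r ^+ 2 / 8 => dv.
have e0 : 0 <= e by rewrite divr_ge0// !mulr_ge0.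
have ce : c * e <= y / 8.
  have -> : y / 8 = (K * w ^+ 2) * e by rewrite /y /e; ring.
  by rewrite ler_wpM2r.
have xc : 128 * x <= 9 * c.
  by rewrite -(ler_pM2l c0); move: H; rewrite expr2; lra.
set c' := c - 8 / 3 * x.
have c'0 : 0 <= c' by rewrite /c'; lra.
have c'c : c' * e <= c * e by rewrite ler_wpM2r// /c'; lra.
have [ec'|c'e] := leP e c'.
  have d0 : 0 <= c - x / 6 - e by move: ec'; rewrite /c'; lra.
  apply: le_trans (dv d0); rewrite ler_wpM2l//.
  apply: (@le_trans _ _ ((c' - e) ^+ 2)).
    have -> : (c' - e) ^+ 2 = c' ^+ 2 - 2 * (c' * e) + e ^+ 2 by ring.
    by have := sqr_ge0 e; lra.
  by rewrite lerXn2r ?nnegrE ?subr_ge0// /c'; lra.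
apply: le_trans v0; apply: mulr_ge0_le0 => //.
have : c' ^+ 2 <= c' * e by rewrite expr2 ler_wpM2l// ltW.
by lra.
Qed.

(* The constants 64 and 8 make both summands of the denominator of
   [patch_radius2] small enough when [w <= 2 Q^2] and [A <= m (2 Q^2)^2]. *)
Lemma poly_radius_le c K w A Q (m : R) : 1 <= Q -> 1 <= m ->
  1 / Q <= c -> 0 <= K <= Q -> 0 <= w <= 2 * Q ^+ 2 ->
  0 <= A <= m * (2 * Q ^+ 2) ^+ 2 -> c <= K * w ^+ 2 ->
  ((64 * Q ^+ 8 * Num.sqrt m)^-1) ^+ 2 <= patch_radius2 c K w A.
Proof.
move=> Q1 m1 cQ /andP[K0 KQ] /andP[w0 wQ] /andP[A0 AQ] cK.
have Q0 : 0 < Q by lra.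
have m0 : 0 < m by lra.
have c0 : 0 < c by apply: lt_le_trans cQ; rewrite divr_gt0.
have Kw : 0 < K * w ^+ 2 := lt_le_trans c0 cK.
have Kp : 0 < K.
  by rewrite lt0r K0 andbT; apply: contraTneq Kw => ->; rewrite mul0r ltxx.
have wp : 0 < w.
  by rewrite lt0r w0 andbT; apply: contraTneq Kw => ->; rewrite expr0n mulr0 ltxx.
have sm : Num.sqrt m ^+ 2 = m by rewrite sqr_sqrtr// ltW.
rewrite /patch_radius2 exprVn.
have -> : (64 * Q ^+ 8 * Num.sqrt m) ^+ 2 = 64 * (64 * (m * Q ^+ 16)).
  by rewrite -[in RHS]sm; ring.
set D := 8 * _.
have D0 : 0 < D.
  rewrite mulr_gt0// ltr_wpDl ?mulr_ge0 ?exprn_ge0 ?(ltW c0)//.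
  by rewrite !mulr_gt0 ?exprn_gt0.
have QX0 n : 0 < Q ^+ n by rewrite exprn_gt0.
rewrite ler_pdivlMr// mulrC ler_pdivrMr; last by rewrite !mulr_gt0.
have Qc : 1 <= c * Q by rewrite -ler_pdivrMr.
have w2 : w ^+ 2 <= 4 * Q ^+ 4.
  have -> : 4 * Q ^+ 4 = (2 * Q ^+ 2) ^+ 2 by ring.
  by rewrite lerXn2r ?nnegrE// (le_trans w0).
have w6 : w ^+ 6 <= 64 * Q ^+ 12.
  have -> : 64 * Q ^+ 12 = (2 * Q ^+ 2) ^+ 6 by ring.
  by rewrite lerXn2r ?nnegrE// (le_trans w0).
have A4 : A <= 4 * m * Q ^+ 4 by move: AQ; congr (_ <= _); ring.
have K2 : K ^+ 2 <= Q ^+ 2 by rewrite lerXn2r ?nnegrE// ltW.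
have T1 : K * w ^+ 2 * A <= Q * (4 * Q ^+ 4) * (4 * m * Q ^+ 4).
  apply: ler_pM => //; first by rewrite !mulr_ge0.
  by apply: ler_pM => //; exact: sqr_ge0.
have T2 : K ^+ 2 * w ^+ 6 <= Q ^+ 2 * (64 * Q ^+ 12).
  by rewrite ler_pM ?exprn_ge0.
have S1 : c * (K * w ^+ 2 * A) <= c * (Q * (4 * Q ^+ 4) * (4 * m * Q ^+ 4)).
  by rewrite ler_wpM2l// ltW.
have cm : 0 < c * m by rewrite mulr_gt0.
(* Each missing factor [c] is paid for by [c * Q >= 1]. The power 16 is dictated by [U2], where
   [Q ^+ 14] lacks two such factors. *)
have U1 : c * m * Q ^+ 9 <= c ^+ 2 * m * Q ^+ 16.
  have -> : c ^+ 2 * m * Q ^+ 16 = c * m * Q ^+ 9 * (c * Q * Q ^+ 6) by ring.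
  rewrite ler_peMr ?mulr_ge0 ?exprn_ge0 ?(ltW c0) ?(ltW m0) ?(ltW Q0)//.
  by rewrite -[1]mulr1 ler_pM// exprn_ege1.
have U2 : Q ^+ 14 <= c ^+ 2 * m * Q ^+ 16.
  have -> : c ^+ 2 * m * Q ^+ 16 = Q ^+ 14 * ((c * Q) * (c * Q) * m) by ring.
  rewrite ler_peMr ?exprn_ge0 ?(ltW Q0)//.
  by rewrite -[1]mulr1 -{1}[1]mulr1 !ler_pM// mulr_ge0.
have -> : 9 * c ^+ 2 * (64 * (64 * (m * Q ^+ 16))) = 9 * (64 * (64 * (c ^+ 2 * m * Q ^+ 16))).
  by ring.
have -> : D = 128 * (c * (K * w ^+ 2 * A)) + 256 * (K ^+ 2 * w ^+ 6).
  by rewrite /D; ring.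
move: S1 T2.
have -> : c * (Q * (4 * Q ^+ 4) * (4 * m * Q ^+ 4)) = 16 * (c * m * Q ^+ 9) by ring.
have -> : Q ^+ 2 * (64 * Q ^+ 12) = 64 * Q ^+ 14 by ring.
by have := QX0 14%N; lra.
Qed.

End PatchArithmetic.

(** * Variance bounds for the loss of a circuit *)

Section PatchVariance.
Variables (R : realType) (k m M : nat) (S : 'I_M -> 'I_m) (V H : 'I_M -> 'M[R[i]]_k).
Variables (rho O : 'M[R[i]]_k) (phi : 'I_m -> R) (p : 'I_m).
Hypotheses (k0 : (0 < k)%N) (Vu : forall l, unitary_mx (V l))
  (Hh : forall l, hermitian_mx (H l)) (rd : density_op rho) (Oh : hermitian_mx O).
Local Notation L := (loss S V H rho O).
Local Notation c := (cp L phi p).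
Local Notation K := (opnorm O).
Local Notation w := (omega_max S H).
Local Notation A := (\sum_(q < m | q != p) w q ^+ 2).

Lemma sum_omega_ge0 : 0 <= A.
Proof. by apply: sumr_ge0 => q _; exact: sqr_ge0. Qed.

Lemma patch_var_ge r : 0 < r -> r ^+ 2 <= patch_radius2 c K (w p) A ->
  r ^+ 4 / 45 * ((c - 8 / 3 * K * w p ^+ 2 * A * r ^+ 2) ^+ 2
                      - 32 / 3 * K ^+ 2 * w p ^+ 6 * r ^+ 2) <= unif_var phi r L.
Proof.
move=> r0 rP; have LD := loss_deriv_bounded S k0 Vu Hh 4 rd Oh.
have w0 := omega_max_ge0 S k0 Hh.
have [c0 cD] := patch_radiusP (normr_ge0 _) (opnorm_ge0 O) (w0 p) sum_omega_ge0 r0 rP.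
apply: patch_lower_term cD _ _ => //.
- exact: opnorm_ge0.
- exact: sum_omega_ge0.
- exact: ltW.
- exact: cp_le.
- exact/unif_var_ge0/ltW.
- exact: unif_var_ge.
Qed.

Lemma patch_var_simple_ge r : 0 < r -> r ^+ 2 <= patch_radius2 c K (w p) A ->
  1 / 72 * c ^+ 2 * r ^+ 4 <= unif_var phi r L.
Proof.
move=> r0 rP; apply: le_trans (patch_var_ge r0 rP).
have w0 := omega_max_ge0 S k0 Hh.
have [_ cD] := patch_radiusP (normr_ge0 _) (opnorm_ge0 O) (w0 p) sum_omega_ge0 r0 rP.
have -> : 1 / 72 * c ^+ 2 * r ^+ 4 = r ^+ 4 / 45 * (5 / 8 * c ^+ 2) by field.
rewrite ler_wpM2l ?divr_ge0 ?exprn_ge0 ?(ltW r0)//.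
exact: patch_main_term.
Qed.

Lemma patch_radius2_ge0 : 0 <= patch_radius2 c K (w p) A.
Proof.
apply: divr_ge0; first by apply: mulr_ge0 => //; exact: sqr_ge0.
apply: patch_denom_ge0.
- exact: normr_ge0.
- exact: opnorm_ge0.
- exact: omega_max_ge0.
- exact: sum_omega_ge0.
Qed.

Lemma patch_var_at_radius :
  1 / 72 * c ^+ 2 * Num.sqrt (patch_radius2 c K (w p) A) ^+ 4
    <= unif_var phi (Num.sqrt (patch_radius2 c K (w p) A)) L.
Proof.
(* The radius vanishes when [c] or the denominator does; the lower bound is then 0. *)
set r := Num.sqrt _; have [r0|rn0] := eqVneq r 0.
  by rewrite r0 expr0n mulr0 unif_var_ge0.
have rp : 0 < r by rewrite lt0r rn0 sqrtr_ge0.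
by apply: patch_var_simple_ge => //; rewrite sqr_sqrtr// patch_radius2_ge0.
Qed.

(** In the bound [c^2 r^4 / 72], the exponent 34 consists of 2 from [c >= 1 / Q] and 32 from the
    fourth power of [Q ^+ 8] in the radius; that power also gives [m^2]. *)
Lemma poly_var_ge Q : 1 <= Q -> K <= Q -> (forall l, opnorm (H l) <= Q) ->
  (forall q, #|[set l | S l == q]%SET|%:R <= Q) -> 1 / Q <= c ->
  1 / (72 * 64 ^+ 4 * Q ^+ 34 * m%:R ^+ 2)
    <= unif_var phi (64 * Q ^+ 8 * Num.sqrt m%:R)^-1 L.
Proof.
move=> Q1 KQ HQ SQ cQ.
have Q0 : 0 < Q by lra.
have w0 := omega_max_ge0 S k0 Hh.
(* At most [Q] generators share a parameter, each of spread at most [2 * Q]. *)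
have wQ q : w q <= 2 * Q ^+ 2.
  apply: (@le_trans _ _ (\sum_(l < M | S l == q) 2 * Q)).
    apply: ler_sum => l _; apply: le_trans (spread_le k0 (Hh l)) _.
    exact: (ler_wpM2l (ler0n _ 2) (HQ l)).
  have -> : 2 * Q ^+ 2 = Q * (2 * Q) by ring.
  rewrite sumr_const -[_ *+ #|_|]mulr_natl.
  apply: ler_wpM2r; first by rewrite mulr_ge0 ?(ltW Q0).
  by apply: le_trans (SQ q); rewrite cardsE.
have m1 : 1 <= m%:R :> R by rewrite ler1n; case: m p => [[]|].
have m0 : 0 < m%:R :> R by lra.
have AQ : A <= m%:R * (2 * Q ^+ 2) ^+ 2.
  apply: (@le_trans _ _ (\sum_(q < m) (2 * Q ^+ 2) ^+ 2)).
    rewrite big_mkcond ler_sum// => q _; case: ifP => _; last exact: sqr_ge0.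
    by rewrite lerXn2r ?nnegrE// (le_trans (w0 q)).
  by rewrite sumr_const card_ord -[leLHS]mulr_natl.
have s0 : 0 < Num.sqrt m%:R :> R by rewrite sqrtr_gt0.
have rp : 0 < (64 * Q ^+ 8 * Num.sqrt m%:R)^-1.
  by rewrite invr_gt0 !mulr_gt0 ?exprn_gt0.
apply: le_trans (patch_var_simple_ge rp _); last first.
  apply: poly_radius_le (Q1) m1 cQ _ _ _ _.
  - by rewrite opnorm_ge0.
  - by rewrite w0 wQ.
  - by rewrite sum_omega_ge0.
  - exact: (cp_le phi p (loss_deriv_bounded S k0 Vu Hh 4 rd Oh)).
have -> : 1 / (72 * 64 ^+ 4 * Q ^+ 34 * m%:R ^+ 2) =
   1 / 72 * (1 / Q) ^+ 2 * (64 * Q ^+ 8 * Num.sqrt m%:R)^-1 ^+ 4.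
  rewrite -{1}(sqr_sqrtr (ltW m0)); field.
  by rewrite !lt0r_neq0.
rewrite ler_wpM2r ?exprn_ge0 ?(ltW rp)// ler_wpM2l ?divr_ge0//.
by rewrite lerXn2r ?nnegrE ?divr_ge0 ?normr_ge0// ltW.
Qed.

End PatchVariance.

Local Close Scope classical_set_scope.

Theorem theorem4 (R : realType) :
  (* Parts 1 and 2: a single instance *)
  (forall (n m M : nat) (S : 'I_M -> 'I_m) (V H : 'I_M -> 'M[R[i]]_(2 ^ n))
          (rho O : 'M[R[i]]_(2 ^ n)) (phi : 'I_m -> R) (p : 'I_m),
    (forall q : 'I_m, exists l : 'I_M, S l = q) ->
    (forall l, unitary_mx (V l)) ->
    (forall l, hermitian_mx (H l)) ->
    density_op rho ->
    hermitian_mx O ->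
    let L := loss S V H rho O in
    let c := cp L phi p in
    let K := opnorm O in
    let w := omega_max S H in
    let A := \sum_(q < m | q != p) w q ^+ 2 in
    let rpatch2 :=
      9 * c ^+ 2 / (8 * (16 * c * K * w p ^+ 2 * A + 32 * K ^+ 2 * w p ^+ 6)) in
    (forall r : R, 0 < r -> r ^+ 2 <= rpatch2 ->
       r ^+ 4 / 45 * ((c - 8 / 3 * K * w p ^+ 2 * A * r ^+ 2) ^+ 2
                      - 32 / 3 * K ^+ 2 * w p ^+ 6 * r ^+ 2)
       <= unif_var phi r L)
    /\ 1 / 72 * c ^+ 2 * (Num.sqrt rpatch2) ^+ 4
       <= unif_var phi (Num.sqrt rpatch2) L)
  /\
  (* Part 3: asymptotics for a family of instances indexed by n *)
  (forall (F : forall n : nat, pqc_instance R n)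
          (phi : forall n : nat, 'I_(pq_m (F n)) -> R)
          (p : forall n : nat, 'I_(pq_m (F n))),
    (exists (C : R) (k N : nat), forall n : nat, (N <= n)%N ->
       [/\ opnorm (pq_O (F n)) <= C * n%:R ^+ k,
           (forall l, opnorm (pq_H (F n) l) <= C * n%:R ^+ k) &
           (forall q, #|[set l | pq_S (F n) l == q]|%:R <= C * n%:R ^+ k)]) ->
    (exists (C : R) (k N : nat), 0 < C /\ forall n : nat, (N <= n)%N ->
       1 / (C * n%:R ^+ k) <= cp (pq_loss (F n)) (phi n) (p n)) ->
    exists (r : nat -> R) (c1 c2 C : R) (a b N : nat),
      [/\ 0 < c1, 0 < c2, 0 < C &
      forall n : nat, (N <= n)%N ->
        [/\ 0 < r n,
            c1 / (n%:R ^+ a * Num.sqrt (pq_m (F n))%:R) <= r n,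
            r n <= c2 / (n%:R ^+ a * Num.sqrt (pq_m (F n))%:R) &
            1 / (C * n%:R ^+ b * (pq_m (F n))%:R ^+ 2)
              <= unif_var (phi n) (r n) (pq_loss (F n))]]).
Proof.
split=> [n m M S V H rho O phi p _ Vu Hh rd Oh L c K w A rpatch2|F phi p].
  have k0 : (0 < 2 ^ n)%N by rewrite expn_gt0.
  split; first by move=> r; exact: patch_var_ge.
  exact: patch_var_at_radius.
move=> [C1 [k1 [N1 H1]]] [C2 [k2 [N2 [C20 H2]]]].
(* A single [B n^k] dominates both given polynomials; [C1] may be negative, and the final 1 ensures
   [B >= 1]. *)
pose B := `|C1| + C2 + 1; pose k := (k1 + k2)%N.
have B1 : 1 <= B by rewrite /B lerDr addr_ge0// ltW.
have B0 : 0 < B by exact: lt_le_trans B1.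
have poly_le (b : R) j n : b <= B -> (0 < n)%N -> (j <= k)%N ->
    b * n%:R ^+ j <= B * n%:R ^+ k.
  move=> bB n0 jk; apply: (@le_trans _ _ (B * n%:R ^+ j)).
    by apply: ler_wpM2r => //; exact: exprn_ge0.
  by apply: ler_wpM2l; [exact: ltW | apply: ler_weXn2l => //; rewrite ler1n].
have C1B : C1 <= B by rewrite /B; have := ler_norm C1; lra.
have C2B : C2 <= B by rewrite /B; have := normr_ge0 C1; lra.
pose c1 := (64 * B ^+ 8)^-1.
have c10 : 0 < c1 by rewrite invr_gt0 mulr_gt0// exprn_gt0.
(* This radius is [(64 Q^8 sqrt m)^-1] with [Q = B n^k], so [c1] serves on both sides of the
   estimate. The 1 in the threshold keeps [n] positive, so that powers of [n] are at least 1. *)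
exists (fun n => c1 / (n%:R ^+ (k * 8) * Num.sqrt (pq_m (F n))%:R)), c1, c1,
  (72 * 64 ^+ 4 * B ^+ 34), (k * 8)%N, (k * 34)%N, (maxn 1 (maxn N1 N2)).
split=> //; first by rewrite !mulr_gt0 ?exprn_gt0.
move=> n; rewrite !geq_max => /and3P[n0 N1n N2n].
have [nO nH nS] := H1 n N1n; have cn := H2 n N2n.
pose Q := B * n%:R ^+ k.
have nk j : 1 <= n%:R ^+ j :> R by rewrite exprn_ege1// ler1n.
have Q1 : 1 <= Q by rewrite -[1]mulr1 ler_pM.
have k1k : (k1 <= k)%N by exact: leq_addr.
have k2k : (k2 <= k)%N by exact: leq_addl.
have m0 : 0 < (pq_m (F n))%:R :> R.
  by rewrite ltr0n; case: (pq_m (F n)) (p n) => [[]|].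
have dQ : 0 < C2 * n%:R ^+ k2 by rewrite mulr_gt0//; exact: lt_le_trans (nk _).
have E8 : c1 / (n%:R ^+ (k * 8) * Num.sqrt (pq_m (F n))%:R) =
    (64 * Q ^+ 8 * Num.sqrt (pq_m (F n))%:R)^-1.
  by rewrite /c1 -invfM /Q exprMn -exprM !mulrA.
have E34 : 72 * 64 ^+ 4 * B ^+ 34 * n%:R ^+ (k * 34) * (pq_m (F n))%:R ^+ 2 =
    72 * 64 ^+ 4 * Q ^+ 34 * (pq_m (F n))%:R ^+ 2.
  by rewrite /Q [(B * _) ^+ _]exprMn -exprM !mulrA.
split=> //.
  by rewrite divr_gt0// mulr_gt0 ?sqrtr_gt0//; exact: lt_le_trans (nk _).
have k0 : (0 < 2 ^ n)%N by rewrite expn_gt0.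
rewrite E34 E8; refine (poly_var_ge k0 (pq_unitary _ _ (F n)) (pq_hermH _ _ (F n))
  (pq_density _ _ (F n)) (pq_hermO _ _ (F n)) Q1 _ _ _ _).
- exact: le_trans nO (poly_le _ _ _ C1B n0 k1k).
- by move=> l; exact: le_trans (nH l) (poly_le _ _ _ C1B n0 k1k).
- by move=> q; exact: le_trans (nS q) (poly_le _ _ _ C1B n0 k1k).
- apply: le_trans cn; rewrite !div1r lef_pV2 ?posrE//; last exact: lt_le_trans Q1.
  exact: poly_le.
Qed.
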